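(* Let $M$ be a countable set and let $G \leq \mathrm{Sym}(M)$ be a permutation group with no algebraicity such that for every $a \in M$, the stabilizer $G_a$ is a maximal subgroup of $G$ (i.e., the action on every orbit is primitive). Suppose, moreover, that at least one of the following conditions holds: (i) $G \curvearrowright M$ has uniform non-algebraicity; or (ii) for any $a \in M$, $G_a$ is boundedly maximal. Let $G \curvearrowright \Omega = [0,1]^M$ be the shift action and let $\mu$ be an invariant Borel probability measure. Then $\mathcal{T} = \mathcal{J}$, where $\mathcal{T}$ is the dynamical tail $\sigma$-field and $\mathcal{J}$ is the invariant $\sigma$-field. In particular, the coordinate projections $\xi_a \colon \Omega \to [0,1]$, $a \in M$, are conditionally independent over $\mathcal{J}$, and if the action is ergodic, the measure $\mu$ is a product measure.
   Context: $G_{(A)}$ denotes the pointwise stabilizer of $A \subseteq M$. $G \curvearrowright M$ has no algebraicity if for every finite $A \subseteq M$, all orbits of $G_{(A)}$ on $M \setminus A$ are infinite. Two finite tuples $\bar a,\bar b\in M^n$ have the same type, $\mathrm{tp}\,\bar a=\mathrm{tp}\,\bar b$, if they lie in the same orbit of the diagonal action $G \curvearrowright M^n$; two countably infinite tuples have the same type if all their corresponding finite initial segments do (so for an infinite $\bar b = (b_0,b_1,\dots)$ and $a\in M$, $\mathrm{tp}(\bar b a)=\mathrm{tp}(\bar b' a')$ means that for every $n$, $(b_0,\dots,b_{n-1},a)$ and $(b'_0,\dots,b'_{n-1},a')$ are in the same $G$-orbit). $G \curvearrowright M$ has uniform non-algebraicity if for all finite or countably infinite tuples $\bar b$ from $M$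 and all $a \in M$ not occurring in $\bar b$, there exist a tuple $\bar b'$ from $M$ and $a' \neq a''$ in $M$ with $\mathrm{tp}(\bar b' a') = \mathrm{tp}(\bar b' a'') = \mathrm{tp}(\bar b a)$. $G_a$ is boundedly maximal in $G$ if there is $d \in \mathbb{N}$ such that for every $g \in G\setminus G_a$, every element of $G$ can be written as a word of length at most $d$ in $g$, $g^{-1}$ and elements of $G_a$. The shift action is $(g\cdot\omega)(a) = \omega(g^{-1}\cdot a)$, and $\xi_a(\omega) = \omega(a)$. $\mathrm{MALG}(\mu)$ is the Boolean algebra of measurable sets modulo null sets, with metric $\mu(E\,\triangle\,F)$; a $\sigma$-field is identified with a closed subalgebra of $\mathrm{MALG}(\mu)$. For finite $A \subseteq M$, $\mathcal{F}_A = \{E \in \mathrm{MALG}(\mu) : g\cdot E = E \text{ for all } g \in G_{(A)}\}$; for arbitrary $D \subseteq M$, $\mathcal{F}_D = \overline{\bigcup\{\mathcal{F}_A : A \subseteq D \text{ finite}\}}$. The invariant $\sigma$-field is $\mathcal{J} = \mathcal{F}_\emptyset = \{E \in \mathrm{MALG}(\mu): g\cdot E = E \text{ for all } g \in G\}$, and the action is ergodic if $\mathcal{J}$ is trivial. The dynamical tail $\sigma$-field is $\mathcal{T} = \bigcap\{\mathcal{F}_{M\setminus A} : A \subseteq M \text{ finite}\}$. *)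

(* Defs.v *)
From HB Require Import structures.
From mathcomp Require Import all_boot all_order all_algebra.
From mathcomp Require Import all_classical all_reals all_analysis.

Set Implicit Arguments.
Unset Strict Implicit.
Unset Printing Implicit Defensive.

Import Order.TTheory GRing.Theory Num.Theory.
Import numFieldNormedType.Exports.

Local Open Scope classical_set_scope.
Local Open Scope ring_scope.

Record sym (M : Type) := Sym {
  sym_fun :> M -> M;
  sym_inv : M -> M;
  symK : cancel sym_fun sym_inv;
  symVK : cancel sym_inv sym_fun
}.

Lemma sym_ext (M : Type) (g h : sym M) : (forall x, g x = h x) -> g = h.
Proof.
case: g => g g' gK g'K; case: h => h h' hK h'K /= /funext gh.
subst h; have e : g' = h' by apply/funext => x; rewrite -{1}(h'K x) gK.
by subst h'; rewrite (Prop_irrelevance gK hK) (Prop_irrelevance g'K h'K).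
Qed.

HB.instance Definition _ (M : Type) := gen_eqMixin (sym M).
HB.instance Definition _ (M : Type) := gen_choiceMixin (sym M).

Section SymGroup.
Variable M : Type.
Implicit Types g h k : sym M.

Definition sym_one : sym M := @Sym M id id (frefl _) (frefl _).

Definition sym_inverse g : sym M := Sym (symVK g) (symK g).

(* Left-action convention: (g * h) x = g (h x), the opposite of the
   convention for {perm T}. *)
Definition sym_mul g h : sym M :=
  Sym (can_comp (symK g) (symK h)) (can_comp (symVK h) (symVK g)).

Lemma sym_mulA : associative sym_mul.
Proof. by move=> g h k; exact: sym_ext. Qed.

Lemma sym_mul1 : left_id sym_one sym_mul.
Proof. by move=> g; exact: sym_ext. Qed.

Lemma sym_1mul : right_id sym_one sym_mul.
Proof. by move=> g; exact: sym_ext. Qed.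

Lemma sym_mulV : left_inverse sym_one sym_inverse sym_mul.
Proof. by move=> g; apply: sym_ext => x /=; rewrite symK. Qed.

Lemma sym_Vmul : right_inverse sym_one sym_inverse sym_mul.
Proof. by move=> g; apply: sym_ext => x /=; rewrite symVK. Qed.

HB.instance Definition _ := isGroup.Build (sym M)
  sym_mulA sym_mul1 sym_1mul sym_mulV sym_Vmul.

End SymGroup.

Section PermutationGroups.
Variable M : eqType.
Implicit Types (G H K : set (sym M)) (A : set M) (a : M) (s : seq M).

Definition subgroup H := group_closed [in H].

Definition maximal_subgroup G H :=
  [/\ subgroup H, H `<` G &
      forall K, subgroup K -> H `<=` K -> K `<=` G -> K = H \/ K = G].

Definition stab G a : set (sym M) := [set g | G g /\ g a = a].

Definition pstab G A : set (sym M) :=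
  [set g | G g /\ forall a, A a -> g a = a].

Definition no_algebraicity G :=
  forall A, finite_set A ->
  forall a, ~ A a -> infinite_set [set g a | g in pstab G A].

Definition boundedly_maximal G H :=
  exists d : nat, forall g, G g -> ~ H g -> forall h, G h ->
  exists w : seq (sym M),
    [/\ (size w <= d)%N,
        forall x, x \in w -> [\/ x = g, x = (g^-1)%g | H x] &
        h = (\prod_(x <- w) x)%g].

(* A finite tuple is a sequence; sequences of different sizes never have the
   same type. *)
Definition same_type G s t := exists2 g, G g & map g s = t.

(* The type of the infinite tuple b extended by a, given by the finite
   segments (b_0, ..., b_(n-1), a). *)
Definition same_type_ext G (b : nat -> M) a (b' : nat -> M) a' :=
  forall n, same_type G (rcons (mkseq b n) a) (rcons (mkseq b' n) a').

Definition uniform_non_algebraicity G :=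
  (forall s a, a \notin s ->
     exists s' a' a'', [/\ a' <> a'',
       same_type G (rcons s' a') (rcons s a) &
       same_type G (rcons s' a'') (rcons s a)]) /\
  (forall (b : nat -> M) a, (forall n, a <> b n) ->
     exists b' a' a'', [/\ a' <> a'',
       same_type_ext G b' a' b a &
       same_type_ext G b' a'' b a]).

End PermutationGroups.

Definition unit_interval (R : realType) : Type := set_type (`[0, 1]%classic : set R).

Lemma unit_interval0 (R : realType) : (0 : R) \in (`[0, 1]%classic : set R).
Proof. by rewrite inE /= in_itv /= lexx ler01. Qed.

HB.instance Definition _ (R : realType) := Topological.on (unit_interval R).
HB.instance Definition _ (R : realType) :=
  isPointed.Build (unit_interval R) (exist _ 0 (unit_interval0 R)).

(* The library declares the point of a product only on the underlying type of
   functions. *)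
HB.instance Definition _ (I : Type) (T : I -> ptopologicalType) :=
  Pointed.copy (prod_topology T) (forall i, T i).

Definition borel (T : ptopologicalType) := g_sigma_algebraType (@open T).
HB.instance Definition _ (T : ptopologicalType) := Measurable.on (borel T).

Notation Omega M R := (borel {ptws M -> unit_interval R}).

Section Shift.
Variables (M : Type) (R : realType).

Definition shift_act (g : sym M) (w : Omega M R) : Omega M R :=
  fun a => w ((g^-1)%g a).

Definition xi (a : M) (w : Omega M R) : borel (unit_interval R) := w a.

Definition shift_invariant (G : set (sym M)) (mu : probability (Omega M R) R) :=
  forall g, G g -> forall E, measurable E -> mu (shift_act g @` E) = mu E.

End Shift.

(* A subset of MALG(mu) is represented by the family of all measurable sets
   whose class modulo null sets belongs to it; equality of such families is
   equality of subsets of MALG(mu). *)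
Definition malg_closure d (T : measurableType d) (R : realType)
    (mu : probability T R) (S : set (set T)) : set (set T) :=
  [set E | measurable E /\
     forall e : R, 0 < e -> exists2 F, S F & (mu (E `+` F) < e%:E)%E].

Section SigmaFields.
Variables (M : eqType) (R : realType).
Variables (G : set (sym M)) (mu : probability (Omega M R) R).

Definition fixed_field (H : set (sym M)) : set (set (Omega M R)) :=
  [set E | measurable E /\
     forall g, H g -> mu ((shift_act g @` E) `+` E) = 0%E].

Definition fin_field (A : set M) := fixed_field (pstab G A).

Definition field_of (D : set M) : set (set (Omega M R)) :=
  malg_closure mu
    (\bigcup_(A in [set A | finite_set A /\ A `<=` D]) fin_field A).

Definition invariant_field := fixed_field G.

Definition dynamical_tail : set (set (Omega M R)) :=
  \bigcap_(A in [set A | finite_set A]) field_of (~` A).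

Definition ergodic :=
  forall E, invariant_field E -> mu E = 0%E \/ mu E = 1%E.

End SigmaFields.

Section Independence.
Context d (T : measurableType d) (R : realType) (mu : probability T R).
Implicit Types (F : set (set T)) (E C : set T).

(* f is a version of the conditional probability of E given the sigma-field F,
   which is assumed to consist of measurable sets. *)
Definition cond_prob_version F E (f : T -> R) :=
  [/\ forall B : set R, measurable B -> F (f @^-1` B),
      mu.-integrable setT (EFin \o f) &
      forall C, F C -> (\int[mu]_(x in C) (f x)%:E)%E = mu (E `&` C)].

(* Versions are unique almost everywhere, so that the choice of the f i is
   immaterial. *)
Definition cond_independent d' (U : measurableType d') (I : eqType)
    F (X : I -> T -> U) :=
  forall s : seq I, uniq s ->
  forall B : I -> set U, (forall i, measurable (B i)) ->
  exists f : I -> T -> R,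
    (forall i, i \in s -> cond_prob_version F (X i @^-1` B i) (f i)) /\
    cond_prob_version F (\bigcap_(i in [set` s]) (X i @^-1` B i))
      (fun x => \prod_(i <- s) f i x).

End Independence.

(* The product of the nu a is the unique probability measure with these values
   on finite-dimensional cylinders. *)
Definition product_measure (M : eqType) (R : realType)
    (mu : probability (Omega M R) R) :=
  exists nu : M -> probability (borel (unit_interval R)) R,
  forall s : seq M, uniq s ->
  forall B : M -> set (borel (unit_interval R)), (forall a, measurable (B a)) ->
  mu (\bigcap_(a in [set` s]) (xi a @^-1` B a)) =
  (\prod_(a <- s) nu a (B a))%E.

(* Main.v *)
Require Import Defs.
From mathcomp Require Import all_boot all_order all_algebra.
From mathcomp Require Import all_classical all_reals all_analysis.
From HB Require Import structures.
From mathcomp Require Import measurable_realfun ring lra.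

(* Let a be a point of M and E an event fixed by G_a that is also approximated
   by events fixed by pointwise stabilizers of finite sets avoiding a. Then E is
   G-invariant: its stabilizer in G contains the maximal subgroup G_a, and it
   contains an element moving a. Under bounded maximality, an element of G that
   fixes a good approximation of E but moves a displaces E very little, so that
   all of G displaces E very little; under uniform non-algebraicity, an infinite
   tuple enumerating M \ {a} determines E, and realizes its type with a in two
   ways.

   Consequently, if E depends on the coordinate a only, its conditional
   probability f given F_{M \ a}, being G_a-invariant by uniqueness, is
   measurable with respect to the invariant field J. Hence 1_E can be replaced
   by f when integrated against an F_{M \ a}-measurable function. Doing this for
   one coordinate after the other gives, for every tail event C and all cylinders
   with bases E_i, that mu(C /\ E_1 /\ ... /\ E_n) is the integral of
   f_1 ... f_n over C. For C in J this is conditional independence over J. For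
   tail events C it shows that 1_C and its conditional expectation given J have
   the same integral over every cylinder, so that they are equal. *)

Set Implicit Arguments.
Unset Strict Implicit.
Unset Printing Implicit Defensive.

Import Order.TTheory GRing.Theory Num.Theory.
Import numFieldNormedType.Exports.

Local Open Scope classical_set_scope.
Local Open Scope ring_scope.

(** * Bounded measurable functions and conditional probabilities *)

Section bounded_measurable.
Context (T : pointedType) (R : realType).
Implicit Types (F : set (set T)) (f g : T -> R).

(* Sub-sigma-algebras are families of subsets of the ambient space; [bmeasP]
   gives access to the library's measurable functions, whose domain is then
   [g_sigma_algebraType F]. *)
Definition bmeas F f := (forall B, measurable B -> F (f @^-1` B)) /\
  exists K : R, forall x, `|f x| <= K.

Lemma bmeasP F f : sigma_algebra setT F ->
  bmeas F f <-> measurable_fun setT (f : g_sigma_algebraType F -> R) /\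
    exists K : R, forall x, `|f x| <= K.
Proof.
move=> sF; split=> -[mf bf]; split=> //.
  by move=> _ B mB; rewrite setTI measurable_g_measurableTypeE//; exact: mf.
move=> B mB; have := mf measurableT B mB.
by rewrite setTI measurable_g_measurableTypeE.
Qed.

Lemma bmeas_sub F F' f : F `<=` F' -> bmeas F f -> bmeas F' f.
Proof. by move=> FF' [mf bf]; split=> // B mB; apply: FF'; exact: mf. Qed.

Variable F : set (set T).
Hypothesis sF : sigma_algebra setT F.

Lemma bmeas_cst (c : R) : bmeas F (cst c).
Proof.
by apply/(bmeasP _ sF); split; [exact: measurable_cst|exists `|c|].
Qed.

Lemma bmeas_indic A : F A -> bmeas F (\1_A).
Proof.
move=> FA; apply/(bmeasP _ sF); split; last first.
  by exists 1 => x; rewrite indicE; case: (_ \in _); rewrite ?normr1 ?normr0.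
by apply: measurable_indic; rewrite measurable_g_measurableTypeE.
Qed.

Lemma bmeasD f g : bmeas F f -> bmeas F g -> bmeas F (fun x => f x + g x).
Proof.
move=> /(bmeasP _ sF)[mf [K fK]] /(bmeasP _ sF)[mg [L gL]].
apply/(bmeasP _ sF); split; first exact: measurable_funD.
by exists (K + L) => x; rewrite (le_trans (ler_normD _ _))// lerD.
Qed.

Lemma bmeasM f g : bmeas F f -> bmeas F g -> bmeas F (fun x => f x * g x).
Proof.
move=> /(bmeasP _ sF)[mf [K fK]] /(bmeasP _ sF)[mg [L gL]].
apply/(bmeasP _ sF); split; first exact: measurable_funM.
by exists (K * L) => x; rewrite normrM ler_pM.
Qed.

Lemma bmeasZ c f : bmeas F f -> bmeas F (fun x => c * f x).
Proof. by move=> mf; apply: (bmeasM (bmeas_cst c)). Qed.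

Lemma bmeasB f g : bmeas F f -> bmeas F g -> bmeas F (fun x => f x - g x).
Proof.
move=> mf mg; have := bmeasD mf (bmeasZ (-1) mg).
by under [in X in X -> _]eq_fun do rewrite mulN1r.
Qed.

Lemma bmeas_sum (I : Type) (s : seq I) (h : I -> T -> R) :
  (forall i, bmeas F (h i)) -> bmeas F (fun x => \sum_(i <- s) h i x).
Proof.
move=> mh; elim: s => [|i s IHs].
  by under eq_fun do rewrite big_nil; exact: bmeas_cst.
by under eq_fun do rewrite big_cons; exact: bmeasD.
Qed.

Lemma bmeas_prod (I : eqType) (s : seq I) (h : I -> T -> R) :
  (forall i, i \in s -> bmeas F (h i)) ->
  bmeas F (fun x => \prod_(i <- s) h i x).
Proof.
elim: s => [|i s IHs] mh.
  by under eq_fun do rewrite big_nil; exact: bmeas_cst.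
under eq_fun do rewrite big_cons.
apply: bmeasM; first by apply: mh; rewrite mem_head.
by apply: IHs => j js; apply: mh; rewrite in_cons js orbT.
Qed.

End bounded_measurable.

(** * Expectations of bounded measurable functions *)

Section expectation.
Context d (T : measurableType d) (R : realType) (mu : probability T R).
Implicit Types (f g : T -> R) (F : set (set T)).

Local Notation E f := (Rintegral mu setT f).
Local Notation bm := (bmeas (@measurable d T)).
Let sT := @sigma_algebra_measurable d T.

Lemma bmeas_measurable_fun f : bm f -> measurable_fun setT f.
Proof. by move=> [mf _] _ B mB; rewrite setTI; exact: mf. Qed.

Lemma bmeas_integrable f : bm f -> mu.-integrable setT (EFin \o f).
Proof.
move=> bf; apply: measurable_bounded_integrable => //.
- by rewrite -ge0_fin_numE// fin_num_measure.
- exact: bmeas_measurable_fun.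
- case: bf => _ [K fK]; exists K; split; first exact: num_real.
  by move=> M KM x _ /=; exact: le_trans (fK x) (ltW KM).
Qed.

Lemma expD f g : bm f -> bm g -> E (fun x => f x + g x) = E f + E g.
Proof. by move=> bf bg; rewrite RintegralD//; exact: bmeas_integrable. Qed.

Lemma expB f g : bm f -> bm g -> E (fun x => f x - g x) = E f - E g.
Proof. by move=> bf bg; rewrite RintegralB//; exact: bmeas_integrable. Qed.

Lemma expZ c f : bm f -> E (fun x => c * f x) = c * E f.
Proof. by move=> bf; rewrite RintegralZl//; exact: bmeas_integrable. Qed.

Lemma exp_sum (I : Type) (s : seq I) (h : I -> T -> R) :
  (forall i, bm (h i)) ->
  E (fun x => \sum_(i <- s) h i x) = \sum_(i <- s) E (h i).
Proof.
move=> mh; elim: s => [|i s IHs].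
  under [X in E X]eq_fun do rewrite big_nil.
  by rewrite big_nil Rintegral_cst// mul0r.
under [X in E X]eq_fun do rewrite big_cons.
by rewrite big_cons expD// ?IHs//; exact: bmeas_sum.
Qed.

Lemma exp_cst (c : R) : E (cst c) = c.
Proof.
have e : fine (mu setT) = 1 by rewrite probability_setT.
by rewrite Rintegral_cst// -[RHS]mulr1 -e.
Qed.

Lemma exp_indic A : measurable A -> E (\1_A) = fine (mu A).
Proof. by move=> mA; rewrite /Rintegral integral_indic// setIT. Qed.

Lemma exp_restrict A f : E (fun x => \1_A x * f x) = Rintegral mu A f.
Proof.
rewrite [RHS]Rintegral_mkcond; congr (Rintegral _ _ _); apply/funext => x.
by rewrite patchE indicE; case: ifPn => _; rewrite ?mul1r ?mul0r.
Qed.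

Lemma exp_norm_le (c : R) f : bm f -> (forall x, `|f x| <= c) -> `|E f| <= c.
Proof.
move=> bf fc; apply: (le_trans (le_normr_Rintegral _ (bmeas_integrable bf))) => //.
rewrite -[leRHS]exp_cst.
apply: le_Rintegral => //; last first.
  exact/bmeas_integrable/(bmeas_cst sT).
apply/bmeas_integrable; split.
  move=> B mB; rewrite -[X in measurable X]setTI.
  apply: measurableT_comp => //; exact: bmeas_measurable_fun.
by exists c => x; rewrite normr_id.
Qed.

(** This is how uniqueness of conditional probabilities is obtained: the difference of two versions
    is orthogonal to the sigma-field and measurable for it, hence orthogonal to itself. *)
Lemma exp_sqr_eq0 f : bm f -> E (fun x => f x * f x) = 0 ->
  mu [set x | f x != 0] = 0%E.
Proof.
move=> bf Ef0; have bff := bmeasM sT bf bf.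
have mf := bmeas_measurable_fun bff.
have /(ae_eq_integral_abs mu measurableT) :
    measurable_fun setT (EFin \o (fun x => f x * f x)).
  exact/measurable_EFinP.
have Ef02 : (\int[mu]_x (f x * f x)%:E = 0)%E.
  have /fineK <- := integrable_fin_num measurableT (bmeas_integrable bff).
  by congr EFin.
case=> + _; case.
  rewrite -[RHS]Ef02; apply: eq_integral => x _ /=.
  by rewrite ger0_norm// -expr2 sqr_ge0.
move=> N [mN N0 fN]; apply/eqP; rewrite eq_le measure_ge0 andbT -N0.
apply: le_measure; rewrite ?inE//.
  have : measurable (f @^-1` (~` [set 0])).
    by case: bf => + _; apply; exact: measurableC.
  by congr measurable; apply/seteqP; split=> x /= /eqP.
move=> x /= fx0; apply: fN => /= /(_ I) [] /eqP.
by rewrite mulf_eq0 (negbTE fx0).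
Qed.

Section sub_sigma_algebra.
Variable F : set (set T).
Hypotheses (sF : sigma_algebra setT F) (Fm : F `<=` measurable).

(** The sum is the integer part of [n.+1%:R * z] divided by [n + 1]. Written with comparisons, it
    becomes a combination of indicators of superlevel sets once [z] is the value of a function. *)
Lemma unit_step_approx (n : nat) (z : R) : 0 <= z <= 1 ->
  `|z - \sum_(k <- iota 0 n.+1)
      n.+1%:R^-1 * ((k.+1%:R <= n.+1%:R * z)%R : nat)%:R| <= n.+1%:R^-1.
Proof.
move=> /andP[z0 z1]; have n0 : (0 : R) < n.+1%:R by rewrite ltr0n.
have nz0 : 0 <= n.+1%:R * z by rewrite mulr_ge0// ltW.
set m := Num.truncn (n.+1%:R * z).
have mn : (m <= n.+1)%N.
  rewrite -(ler_nat R) (@le_trans _ _ (n.+1%:R * z))//.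
    by rewrite truncn_le.
  by rewrite -[leRHS]mulr1 ler_wpM2l// ltW.
have -> : \sum_(k <- iota 0 n.+1)
    n.+1%:R^-1 * ((k.+1%:R <= n.+1%:R * z)%R : nat)%:R = n.+1%:R^-1 * m%:R :> R.
  rewrite -mulr_sumr; congr (_ * _).
  under eq_bigr do rewrite -truncn_ge_nat//.
  rewrite -natr_sum; congr (_%:R).
  rewrite -[iota 0 _]/(index_iota 0 n.+1) (big_cat_nat (leq0n m) mn)//=.
  under eq_big_nat => k /andP[_ km] do rewrite km.
  under [X in (_ + X)%N]eq_big_nat => k /andP[mk _] do rewrite ltnNge mk.
  by rewrite sum_nat_const_nat subn0 muln1 big1// addn0.
have /andP[m1 m2] := truncn_itv nz0; rewrite -/m in m1 m2.
have -> : z - n.+1%:R^-1 * m%:R = n.+1%:R^-1 * (n.+1%:R * z - m%:R).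
  by field; rewrite addrC natr1 lt0r_neq0.
have i0 : (0 : R) <= n.+1%:R^-1 by rewrite invr_ge0 ltW.
rewrite normrM (ger0_norm i0) ger0_norm ?subr_ge0// ler_piMr//.
by rewrite lerBlDl natr1 ltW.
Qed.

(** A function with values in [0,1] is a uniform limit of combinations of indicators of its
    superlevel sets, which belong to [F]. Affine rescaling reduces the bounded case to this one. *)
Lemma orthogonal_bmeas u Z : bm u ->
  (forall C, F C -> E (fun x => u x * \1_C x) = 0) ->
  bmeas F Z -> E (fun x => u x * Z x) = 0.
Proof.
move=> bu uF.
suff unit Y : bmeas F Y -> (forall x, 0 <= Y x <= 1) ->
    E (fun x => u x * Y x) = 0.
  (* The bound [K0] may be 0; adding 1 makes [2 * K] invertible. *)
  move=> bZ; have [_ [K0 ZK0]] := bZ; pose K := K0 + 1.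
  have K0_ge0 : 0 <= K0 := le_trans (normr_ge0 _) (ZK0 point).
  have Kgt0 : 0 < K by rewrite /K; lra.
  pose Y x := (2 * K)^-1 * (Z x + K).
  have bY : bmeas F Y.
    by apply: bmeasZ => //; apply: bmeasD => //; exact: bmeas_cst.
  have Y01 x : 0 <= Y x <= 1.
    have := ZK0 x; rewrite ler_norml => /andP[z1 z2].
    apply/andP; split; rewrite /Y.
      by rewrite mulr_ge0// ?invr_ge0; rewrite ?/K; lra.
    by rewrite ler_pdivrMl ?mulr1 ?mulr_gt0//; rewrite /K; lra.
  (* The constant is written with the indicator of [setT], so that the hypothesis on [u] disposes of
     it as well. *)
  have YE x : Z x = (2 * K) * Y x - K * \1_setT x.
    by rewrite /Y indicT /=; field; rewrite lt0r_neq0.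
  have buY : bm (fun x => u x * Y x).
    by apply: bmeasM => //; exact: bmeas_sub bY.
  have bu1 : bm (fun x => u x * \1_setT x).
    by apply: bmeasM => //; exact: bmeas_indic.
  rewrite (_ : (fun _ => _) = (fun x =>
      (2 * K) * (u x * Y x) - K * (u x * \1_setT x))); last first.
    by apply/funext => x; rewrite YE; ring.
  rewrite expB; [|exact: bmeasZ..].
  rewrite !expZ// unit// uF ?mulr0 ?subr0//.
  by rewrite -setC0 -setTD; case: sF => F0 + _; exact.
move=> bY Y01.
have [_ [L uL]] := bu.
(* [Yn n] is floor((n + 1) Y) / (n + 1). *)
pose Yn n x : R := \sum_(k <- iota 0 n.+1)
      n.+1%:R^-1 * \1_[set x | k.+1%:R <= n.+1%:R * Y x] x.
have FYn n k : F [set x | k.+1%:R <= n.+1%:R * Y x].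
  have [+ _] := bmeasZ sF n.+1%:R bY.
  move=> /(_ `[k.+1%:R, +oo[%classic (measurable_itv _)).
  by congr F; apply/seteqP; split=> x /=; rewrite in_itv /= andbT.
have bYn n : bmeas F (Yn n).
  by apply: bmeas_sum => // k; apply: bmeasZ => //; exact: bmeas_indic.
have mY := bmeas_sub Fm bY.
have mYn n := bmeas_sub Fm (bYn n).
have EYn n : E (fun x => u x * Yn n x) = 0.
  have -> : (fun x => u x * Yn n x) = (fun x => \sum_(k <- iota 0 n.+1)
      n.+1%:R^-1 * (u x * \1_[set x | k.+1%:R <= n.+1%:R * Y x] x)).
    apply/funext => x; rewrite /Yn mulr_sumr; apply: eq_bigr => k _.
    by rewrite mulrCA.
  have bind k : bm (fun x => u x * \1_[set x | k.+1%:R <= n.+1%:R * Y x] x).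
    by apply: bmeasM => //; apply: bmeas_indic => //; exact: Fm.
  rewrite exp_sum; last by move=> k; exact: bmeasZ.
  by apply: big1 => k _; rewrite expZ// uF ?mulr0.
apply/eqP; rewrite -normr_le0; apply/ler_addgt0Pr => e e0; rewrite add0r.
have L0 : 0 <= L := le_trans (normr_ge0 _) (uL point).
(* Since [Yn n] is within [1 / (n + 1)] of [Y] and [u] is bounded by [L], the error is at most
   [L / (n + 1)]. *)
pose n := Num.truncn (L / e).
have Ln : L / n.+1%:R <= e.
  have := truncnS_gt (L / e); rewrite -/n => /ltW.
  by rewrite ler_pdivrMr// mulrC -ler_pdivrMr ?ltr0n.
apply: le_trans Ln.
have -> : E (fun x => u x * Y x) = E (fun x => u x * (Y x - Yn n x)).
  rewrite (_ : (fun x => u x * (Y x - Yn n x)) =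
      (fun x => u x * Y x - u x * Yn n x)); last first.
    by apply/funext => x; rewrite mulrBr.
  by rewrite expB ?EYn ?subr0//; exact: bmeasM.
apply: exp_norm_le; first by apply: bmeasM => //; exact: bmeasB.
move=> x; rewrite normrM ler_pM//.
have := unit_step_approx n (Y01 x); congr (_ <= _).
congr (`|_ - _|); apply: eq_bigr => k _; rewrite indicE.
by congr (_ * (nat_of_bool _)%:R); apply/idP/idP; rewrite inE.
Qed.

Section cond_prob.
Variable A : set T.
Hypothesis mA : measurable A.

(** The identity as a map to the coarser measurable space: pushing a measure forward along it
    restricts the measure to [F], so that densities of the images are [F]-measurable. *)
Let toF (x : T) : g_sigma_algebraType F := x.

Let measurable_toF : measurable_fun setT toF.
Proof.
by move=> _ B; rewrite measurable_g_measurableTypeE// setTI; exact: Fm.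
Qed.

Let muF := pushforward mu toF.
HB.instance Definition _ := Measure.copy muF
  (@measure_function_pushforward__canonical__measure_function_Measure
    _ _ _ _ _ mu _ measurable_toF).
Let muF_finite : fin_num_fun muF.
Proof.
by move=> B; rewrite measurable_g_measurableTypeE// => /Fm /(fin_num_measure mu).
Qed.
HB.instance Definition _ := Measure_isFinite.Build _ _ _ muF muF_finite.

Let nuF := pushforward (mrestr mu mA) toF.
HB.instance Definition _ := Measure.copy nuF
  (@measure_function_pushforward__canonical__measure_function_Measure
    _ _ _ _ _ (mrestr mu mA) _ measurable_toF).
Let nuF_finite : fin_num_fun nuF.
Proof.
move=> B; rewrite measurable_g_measurableTypeE// => /Fm mB.
exact: (fin_num_measure (mrestr mu mA)).
Qed.
HB.instance Definition _ := Measure_isFinite.Build _ _ _ nuF nuF_finite.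

(** The conditional probability is the Radon-Nikodym density of [nuF], the trace of [mu] on [A],
    with respect to [muF], cut off at 1 to be bounded everywhere. *)
Lemma cond_prob_exists : exists2 f : T -> R, bmeas F f &
  forall C, F C -> E (fun x => f x * \1_C x) = fine (mu (A `&` C)).
Proof.
have nu_mu : nuF `<< muF.
  apply/null_content_dominatesP => B.
  rewrite measurable_g_measurableTypeE// => /Fm mB muB.
  apply/eqP; rewrite eq_le measure_ge0 andbT -muB.
  by apply: le_measure; rewrite ?inE//; exact: measurableI.
have [h [h0 hfin hint hE]] := radon_nikodym_sigma_finite nu_mu.
have mh : measurable_fun setT h := measurable_int _ hint.
(* [h <= 1] almost everywhere, because [nuF <= muF]. *)
pose g x := Num.min (fine (h x)) 1.
pose N : set (g_sigma_algebraType F) := [set x | (1%E < h x)%E].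
have mN : measurable N.
  by rewrite -[N]setTI; exact: emeasurable_fun_o_infty.
have hfine x : (fine (h x))%:E = h x by rewrite fineK.
have mg : measurable_fun setT (g : g_sigma_algebraType F -> R).
  apply: measurable_minr; last exact: measurable_cst.
  apply: (measurableT_comp (f := fine)) mh => //; exact: fine_measurable.
have g0 x : 0 <= g x by rewrite le_min ler01 andbT fine_ge0.
have g1 x : g x <= 1 by rewrite ge_min lexx orbT.
(* The cut-off changes no integral: on [N], where it takes effect, [h > 1] gives [muF <= nuF], while
   [nuF <= muF] always holds. *)
have gh C : measurable C -> (\int[muF]_(x in C) (g x)%:E = nuF C)%E.
  move=> mC; rewrite hE// -(setDUK (@subIsetl _ C N)).
  have mCN : measurable (C `&` N) by exact: measurableI.
  have mCDN : measurable (C `\` (C `&` N)) by exact: measurableD.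
  have dis : [disjoint C `&` N & C `\` (C `&` N)].
    by apply/disj_setPS => x [? []].
  have mgE : measurable_fun setT (EFin \o g) by exact/measurable_EFinP.
  rewrite (ge0_integral_setU _ mCN mCDN (measurable_funTS mgE))//; last first.
    by move=> x _; rewrite /= lee_fin.
  rewrite (ge0_integral_setU _ mCN mCDN (measurable_funTS mh))//.
  congr (_ + _)%E.
    have gN : {in C `&` N, forall x, (g x)%:E = 1%E}.
      move=> x /set_mem[_]; rewrite /N /= -hfine lte_fin => hx.
      by rewrite /g min_r// ltW.
    rewrite (eq_integral _ _ gN) integral_cst// mul1e.
    apply/eqP; rewrite eq_le; apply/andP; split.
      rewrite -[leLHS]mul1e -integral_cst//; apply: ge0_le_integral => //.
        exact: measurable_funTS.
      by move=> x [_ /ltW].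
    have mCN' : d.-measurable (C `&` N).
      by apply: Fm; rewrite -[F]measurable_g_measurableTypeE.
    rewrite -hE//; apply: le_measure; rewrite ?inE//.
    exact: measurableI.
  apply: eq_integral => x /set_mem[Cx CNx]; rewrite /= /g.
  have hx : (h x <= 1)%E by rewrite leNgt; apply/negP => ?; exact: CNx.
  by rewrite min_l ?hfine// -lee_fin hfine.
exists g.
- apply/(bmeasP _ sF); split => //; exists 1 => x.
  by rewrite ger0_norm.
- move=> C FC; under eq_fun do rewrite mulrC.
  have mC : measurable (C : set (g_sigma_algebraType F)).
    by rewrite measurable_g_measurableTypeE.
  rewrite exp_restrict /Rintegral; congr fine.
  have -> : mu (A `&` C) = nuF C by rewrite setIC.
  rewrite -gh//.
  rewrite [RHS]ge0_integral_pushforward//.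
    by apply/measurable_EFinP; exact: measurable_funTS.
  by move=> y _; rewrite lee_fin.
Qed.

End cond_prob.
End sub_sigma_algebra.
End expectation.

(** * Cylinders generate the Borel sets of the product space *)

Section cylinders.
Variables (M : countType) (R : realType).
Implicit Types (a : M) (w : Omega M R).

Definition cylinder (s : seq M) (B : M -> set (borel (unit_interval R))) :
    set (Omega M R) :=
  \bigcap_(a in [set` s]) (@xi M R a @^-1` B a).

Lemma measurable_xi a : measurable_fun setT (@xi M R a).
Proof.
apply: (@measurability _ _ (Omega M R) (borel (unit_interval R)) setT _
  (@open (unit_interval R))) => //.
move=> _ [U oU <-]; rewrite setTI; apply: sub_sigma_algebra.
have := @proj_continuous M (fun=> unit_interval R) a.
by move/(@continuousP {ptws M -> unit_interval R}); exact.
Qed.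

Lemma measurable_xi_preimage a (B : set (borel (unit_interval R))) :
  measurable B -> measurable (@xi M R a @^-1` B).
Proof. by move=> mB; rewrite -[X in measurable X]setTI; exact: measurable_xi. Qed.

Lemma measurable_cylinder s (B : M -> set (borel (unit_interval R))) :
  (forall a, measurable (B a)) -> measurable (cylinder s B).
Proof.
move=> mB; apply: fin_bigcap_measurable => // a _.
exact: measurable_xi_preimage.
Qed.

Definition cylinders : set (set (Omega M R)) :=
  [set E | exists s B, [/\ uniq s, forall a, measurable (B a) &
                        E = cylinder s B]].

Lemma setI_closed_cylinders : setI_closed cylinders.
Proof.
move=> _ _ [s [B [us mB ->]]] [t [C [ut mC ->]]].
(* A coordinate constrained by only one of the two cylinders gets [setT] from the other. *)
exists (undup (s ++ t)), (fun a => (if a \in s then B a else setT) `&`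
  (if a \in t then C a else setT)); split; first exact: undup_uniq.
  by move=> a; apply: measurableI; case: ifP.
apply/seteqP; split=> [w [sw tw] a _ | w stw].
  by split; case: ifPn => // ain; [exact: sw|exact: tw].
split=> a /= ain; have /stw : [set` undup (s ++ t)] a.
- by rewrite /= mem_undup mem_cat ain.
- by case; rewrite ain.
- by rewrite /= mem_undup mem_cat ain orbT.
- by case; rewrite ain.
Qed.

Let open_itv_set (q : rat * rat) : set (borel (unit_interval R)) :=
  @set_val R `[0, 1]%classic @^-1` `]ratr q.1, ratr q.2[%classic.

Let measurable_open_itv_set q : measurable (open_itv_set q).
Proof.
apply: sub_sigma_algebra.
exists `]ratr q.1, ratr q.2[%classic => //; exact: interval_open.
Qed.

(** Indexing by lists of constraints with rational endpoints makes the basic open sets a countable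
    family, as [M] is countable. *)
Let basic (L : seq (M * (rat * rat))) : set (Omega M R) :=
  [set w | all (fun c => `[< open_itv_set c.2 (w c.1) >]) L].

Let measurable_basic L : <<s cylinders >> (basic L).
Proof.
elim: L => [|[a q] L IHL].
  rewrite (_ : basic _ = setT); last exact/seteqP.
  exact: (@measurableT _ (g_sigma_algebraType cylinders)).
rewrite (_ : basic _ = cylinder [:: a] (fun=> open_itv_set q) `&` basic L).
  apply: (@measurableI _ (g_sigma_algebraType cylinders)) => //.
  by apply: sub_sigma_algebra; exists [:: a], (fun=> open_itv_set q); split.
apply/seteqP; split=> w /=.
  by move=> /andP[/asboolP wa wL]; split=> // b; rewrite /= inE => /eqP ->.
by move=> [wa wL]; apply/andP; split=> //; apply/asboolP/wa; rewrite /= inE.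
Qed.

Let open_basic (U : set {ptws M -> unit_interval R}) w : open U -> U w ->
  exists L, basic L w /\ basic L `<=` U.
Proof.
move=> oU Uw.
(* [Fw] converges to [w] in every coordinate, hence in the product. *)
pose Fw : set_system (Omega M R) :=
  [set A | exists L, basic L w /\ basic L `<=` A].
have FFw : Filter Fw.
  split.
  - by exists [::].
  - move=> P Q [L [Lw LP]] [L' [Lw' LQ]]; exists (L ++ L'); split.
      by rewrite /basic /= all_cat; apply/andP.
    by move=> v /=; rewrite /basic /= all_cat => /andP[/LP ? /LQ].
  - by move=> P Q PQ [L [Lw LP]]; exists L; split=> // v /LP /PQ.
have : Fw --> (w : {ptws M -> unit_interval R}).
  apply/cvg_sup => a A [_ [[B [V oV <-] <-] Vw BA]].
  have : nbhs (set_val (w a) : R) V.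
    by apply: open_nbhs_nbhs; split.
  move=> /nbhs_ballP[e /= e0 eV].
  have [q1 q1P] : exists q, ratr q \in `]set_val (w a) - e, set_val (w a)[.
    by apply: rat_in_itvoo; lra.
  have [q2 q2P] : exists q, ratr q \in `]set_val (w a), set_val (w a) + e[.
    by apply: rat_in_itvoo; lra.
  move: q1P q2P; rewrite !in_itv/= => /andP[q11 q12] /andP[q21 q22].
  exists [:: (a, (q1, q2))]; split.
    rewrite /basic /= andbT; apply/asboolP.
    by rewrite /open_itv_set /= in_itv /= q12 q21.
  move=> v; rewrite /basic /= andbT => /asboolP.
  rewrite /open_itv_set /= in_itv /= => /andP[v1 v2]; apply: BA.
  apply: eV; rewrite /ball /= ltr_norml; apply/andP; split.
    by rewrite ltrBrDl -ltrBrDr; lra.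
  by rewrite ltrBlDl; lra.
by apply; apply: open_nbhs_nbhs.
Qed.

(** The product topology is second countable: an open set is the union of the basic sets inside it,
    and basic sets are finite intersections of cylinders. *)
Lemma measurable_cylinders : @measurable _ (Omega M R) = <<s cylinders >>.
Proof.
apply/seteqP; split; last first.
  apply: smallest_sub; first exact: sigma_algebra_measurable.
  move=> _ [s [B [_ mB ->]]].
  exact: measurable_cylinder.
apply: smallest_sub; first exact: smallest_sigma_algebra.
move=> U oU.
(* Basic sets not inside [U] are replaced by the empty set, so that the union runs over a whole
   countable type. *)
pose h L := if `[< basic L `<=` U >] then basic L else set0.
rewrite (_ : U = \bigcup_L h L).
  apply: (@countable_bigcupT_measurable _ (g_sigma_algebraType cylinders)) => //.
  by move=> L; rewrite /h; case: asboolP => _; [exact: measurable_basic|].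
apply/seteqP; split=> [w Uw|w [L _]].
  have [L [Lw LU]] := open_basic oU Uw; exists L => //.
  by rewrite /h; case: asboolP.
by rewrite /h; case: asboolP => // + ?; apply.
Qed.

End cylinders.

(** * The measure algebra *)

Section malg_distance.
Context d (T : measurableType d) (R : realType) (mu : probability T R).
Implicit Types (A B C : set T) (S : set (set T)).

(** The metric of the measure algebra with real values, which allows linear arithmetic on
    distances. *)
Definition symdist A B : R := fine (mu (A `+` B)).

Lemma measurableY A B : measurable A -> measurable B -> measurable (A `+` B).
Proof. by move=> mA mB; apply: measurableU; apply: measurableD. Qed.

Lemma symdistE A B : measurable A -> measurable B ->
  mu (A `+` B) = (symdist A B)%:E.
Proof.
by move=> mA mB; rewrite fineK// fin_num_measure//; exact: measurableY.
Qed.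

Lemma symdist_ge0 A B : 0 <= symdist A B.
Proof. by rewrite fine_ge0. Qed.

Lemma symdistxx A : symdist A A = 0.
Proof. by rewrite /symdist setYK measure0. Qed.

Lemma symdistC A B : symdist A B = symdist B A.
Proof. by rewrite /symdist setYC. Qed.

Lemma fine_measure_le A B : measurable A -> measurable B -> A `<=` B ->
  fine (mu A) <= fine (mu B).
Proof.
move=> mA mB AB; apply: fine_le; rewrite ?fin_num_measure//.
by apply: le_measure; rewrite ?inE.
Qed.

Lemma fine_measureU_le A B C : measurable A -> measurable B -> measurable C ->
  C `<=` A `|` B -> fine (mu C) <= fine (mu A) + fine (mu B).
Proof.
move=> mA mB mC CAB; rewrite -fineD ?fin_num_measure//.
apply: fine_le; rewrite ?fin_numD ?fin_num_measure//.
apply: (@le_trans _ _ (mu (A `|` B))).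
  by apply: le_measure; rewrite ?inE//; exact: measurableU.
exact: measureU2.
Qed.

Lemma symdist_triangle B A C : measurable A -> measurable B -> measurable C ->
  symdist A C <= symdist A B + symdist B C.
Proof.
move=> mA mB mC; apply: fine_measureU_le; [exact: measurableY..|].
by move=> x [[Ax nC]|[Cx nA]]; have [Bx|nB] := pselect (B x);
  [right; left|left; left|left; right|right; right].
Qed.

Lemma symdistCC A B : symdist (~` A) (~` B) = symdist A B.
Proof. by rewrite /symdist /setY !setDE !setCK setUC [A `&` _]setIC [B `&` _]setIC. Qed.

Lemma symdistUU A A' B B' : measurable A -> measurable A' -> measurable B ->
  measurable B' -> symdist (A `|` B) (A' `|` B') <= symdist A A' + symdist B B'.
Proof.
move=> mA mA' mB mB'; apply: fine_measureU_le.
- exact: measurableY.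
- exact: measurableY.
- by apply: measurableY; exact: measurableU.
move=> x /=.
by case=> -[[?|?] /not_orP[? ?]]; [left; left|right; left|left; right|right; right].
Qed.

Lemma symdist_measureI A B C : measurable A -> measurable B -> measurable C ->
  symdist A B = 0 -> mu (A `&` C) = mu (B `&` C).
Proof.
move=> mA mB mC AB.
suff le A' B' : measurable A' -> measurable B' -> symdist A' B' = 0 ->
    fine (mu (A' `&` C)) <= fine (mu (B' `&` C)).
  rewrite -[LHS]fineK ?fin_num_measure//; last exact: measurableI.
  rewrite -[RHS]fineK ?fin_num_measure//; last exact: measurableI.
  by congr EFin; apply/eqP; rewrite eq_le !le// symdistC.
move=> mA' mB' AB'; rewrite -[leRHS]addr0 -AB'.
apply: fine_measureU_le; [exact: measurableI|exact: measurableY|exact: measurableI|].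
move=> x /= [A'x Cx]; have [B'x|nB'x] := pselect (B' x); first by left.
by right; left.
Qed.

Definition set_algebra S :=
  [/\ S set0, forall A, S A -> S (~` A) & forall A B, S A -> S B -> S (A `|` B)].

Section closure.
Variable S : set (set T).
Hypotheses (Sm : S `<=` measurable).

Lemma malg_closureP A : malg_closure mu S A <->
  measurable A /\ forall e : R, 0 < e -> exists2 B, S B & symdist A B < e.
Proof.
by split=> -[mA SA]; split=> // e /SA[B SB AB]; exists B => //; move: AB;
  rewrite symdistE// ?lte_fin//; exact: Sm.
Qed.

Lemma sub_malg_closure : S `<=` malg_closure mu S.
Proof.
move=> A SA; apply/malg_closureP; split; first exact: Sm.
by move=> e e0; exists A; rewrite ?symdistxx.
Qed.

Lemma malg_closure_measurable : malg_closure mu S `<=` measurable.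
Proof. by move=> A []. Qed.

Lemma malg_closure_closed A : measurable A ->
  (forall e : R, 0 < e -> exists2 B, malg_closure mu S B & symdist A B < e) ->
  malg_closure mu S A.
Proof.
move=> mA SA; apply/malg_closureP; split=> // e e0.
have [B /malg_closureP[mB SB] AB] := SA (e / 2) ltac:(lra).
have [C SC BC] := SB (e / 2) ltac:(lra); exists C => //.
have := symdist_triangle mA mB (Sm SC); lra.
Qed.

Hypothesis algS : set_algebra S.

(** Complement and union are continuous for the metric, so the closure is an algebra. By continuity
    from below, a countable union is the limit of its finite partial unions, and the closure is
    closed. *)
Lemma sigma_algebra_malg_closure : sigma_algebra setT (malg_closure mu S).
Proof.
have [S0 SC SU] := algS.
have clU A B : malg_closure mu S A -> malg_closure mu S B ->
    malg_closure mu S (A `|` B).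
  move=> /malg_closureP[mA SA] /malg_closureP[mB SB].
  apply/malg_closureP; split; first exact: measurableU.
  move=> e e0; have [A' SA' AA'] := SA (e / 2) ltac:(lra).
  have [B' SB' BB'] := SB (e / 2) ltac:(lra).
  exists (A' `|` B'); first exact: SU.
  have := symdistUU mA (Sm SA') mB (Sm SB'); lra.
split.
- exact: sub_malg_closure.
- move=> A /malg_closureP[mA SA]; rewrite setTD.
  apply/malg_closureP; split; first exact: measurableC.
  move=> e /SA[B SB AB]; exists (~` B); [exact: SC|by rewrite symdistCC].
move=> A SA; have mA n : measurable (A n) by exact: malg_closure_measurable.
have mU : measurable (\bigcup_k A k) by exact: bigcupT_measurable.
apply: malg_closure_closed => // e e0.
pose U n := \big[setU/set0]_(i < n.+1) A i.
have SU' n : malg_closure mu S (U n).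
  rewrite /U; elim: n => [|n IHn]; rewrite big_ord_recr /=.
    by rewrite big_ord0 set0U.
  exact: clU.
have mUn n := malg_closure_measurable (SU' n).
have : (fine \o (mu \o U)) @ \oo --> fine (mu (\bigcup_k A k)).
  apply: fine_cvg; rewrite fineK ?fin_num_measure// -bigcup_bigsetU_bigcup.
  apply: nondecreasing_cvg_mu => //.
  - by rewrite bigcup_bigsetU_bigcup.
  - by move=> m n mn; apply/subsetPset/subset_bigsetU.
move=> /cvgrPdist_lt/(_ e e0)[n _ /(_ n (leqnn n))] /= ne.
exists (U n) => //.
have UA : U n `<=` \bigcup_k A k.
  by rewrite -bigcup_bigsetU_bigcup => x Ux; exists n.
apply: le_lt_trans ne; apply: le_trans (ler_norm _).
rewrite /symdist /setY (_ : U n `\` _ = set0) ?setU0; last first.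
  by apply/seteqP; split=> x // [/UA].
rewrite measureD//; last by rewrite -ge0_fin_numE// fin_num_measure.
by rewrite setIidr// fineB ?fin_num_measure.
Qed.

End closure.
End malg_distance.


(** * The shift action *)

Section subgroups.
Variables (M : eqType) (G : set (sym M)).
Hypothesis hG : subgroup G.

Lemma subgroup1 : G 1%g.
Proof. by have [/set_mem] := hG. Qed.

Lemma subgroupV g : G g -> G (g^-1)%g.
Proof. by move=> Gg; have /(_ g)/(_ (mem_set Gg))/set_mem := group_closedV hG. Qed.

Lemma subgroupM g h : G g -> G h -> G (g * h)%g.
Proof.
move=> Gg Gh; have /(_ g h (mem_set Gg) (mem_set Gh)) := group_closedM hG.
by move/set_mem.
Qed.

Lemma symMg (g h : sym M) a : (g * h)%g a = g (h a).
Proof. by []. Qed.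

Lemma symKg (g : sym M) a : (g^-1)%g (g a) = a.
Proof. exact: symK. Qed.

Lemma pstab1 a : pstab G [set a] = stab G a.
Proof.
by apply/seteqP; split=> g [Gg ga]; split=> //; [exact: ga|move=> _ ->].
Qed.

Lemma pstab0 : pstab G set0 = G.
Proof. by apply/seteqP; split=> g // []. Qed.

Lemma pstabS (A B : set M) : A `<=` B -> pstab G B `<=` pstab G A.
Proof. by move=> AB g [Gg gB]; split=> // a /AB; exact: gB. Qed.

Lemma pstab_sub (A : set M) : pstab G A `<=` G.
Proof. by move=> g []. Qed.

Lemma pstab_conj (A : set M) g h : G g -> pstab G (g @` A) h ->
  pstab G A (g^-1 * (h * g))%g.
Proof.
move=> Gg [Gh hgA]; split.
  by apply: subgroupM; [exact: subgroupV|exact: subgroupM].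
by move=> a Aa; rewrite !symMg hgA ?symKg//; exact: imageP.
Qed.

End subgroups.

(** * The shift on events, and the sigma-fields of events fixed by subgroups *)

Section shift.
Variables (M : countType) (R : realType).
Implicit Types (g h : sym M) (E F : set (Omega M R)).
Local Notation act g := (@shift_act M R g).

Lemma shift_act1 : act 1%g = id.
Proof. by []. Qed.

Lemma shift_actM g h w : act (g * h)%g w = act g (act h w).
Proof. by []. Qed.

Lemma shift_actK g : cancel (act g) (act (g^-1)%g).
Proof. by move=> w; rewrite -shift_actM mulVg. Qed.

Lemma shift_actVK g : cancel (act (g^-1)%g) (act g).
Proof. by move=> w; rewrite -shift_actM mulgV. Qed.

(** Preimages commute with all set operations and preserve measurability, so images are handled in
    this form. *)
Lemma shift_imageE g E : act g @` E = act (g^-1)%g @^-1` E.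
Proof.
apply/seteqP; split=> [_ [w Ew <-]|w Ew]; first by rewrite /= shift_actK.
by exists (act (g^-1)%g w) => //; rewrite shift_actVK.
Qed.

Lemma shift_imageM g h E : act (g * h)%g @` E = act g @` (act h @` E).
Proof. by rewrite !shift_imageE invgM. Qed.

Lemma shift_imageY g E F : act g @` (E `+` F) = (act g @` E) `+` (act g @` F).
Proof. by rewrite !shift_imageE. Qed.

(** Cylinders suffice, and a constraint on coordinate [a] pulls back to one on coordinate
    [(g^-1)%g a]. *)
Lemma measurable_shift g : measurable_fun setT (act g).
Proof.
apply: (@measurability _ _ (Omega M R) (Omega M R) setT _ (@cylinders M R)).
  exact: measurable_cylinders.
move=> _ [_ [s [B [_ mB ->]]] <-]; rewrite setTI /cylinder preimage_bigcap.
apply: fin_bigcap_measurable => // a _.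
exact: (@measurable_xi_preimage M R ((g^-1)%g a)).
Qed.

Lemma measurable_shift_image g E : measurable E -> measurable (act g @` E).
Proof.
by move=> mE; rewrite shift_imageE -[X in measurable X]setTI; exact: measurable_shift.
Qed.

Variables (G : set (sym M)) (mu : probability (Omega M R) R).
Hypotheses (hG : subgroup G) (hmu : shift_invariant G mu).

Lemma symdist_shift g E F : G g -> measurable E -> measurable F ->
  symdist mu (act g @` E) (act g @` F) = symdist mu E F.
Proof.
by move=> Gg mE mF; rewrite /symdist -shift_imageY hmu//; exact: measurableY.
Qed.

Lemma fixed_fieldP H E : fixed_field mu H E <->
  measurable E /\ forall g, H g -> symdist mu (act g @` E) E = 0.
Proof.
split=> -[mE hE]; split=> // g Hg; first by rewrite /symdist hE.
by rewrite symdistE ?hE//; exact: measurable_shift_image.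
Qed.

Lemma fixed_field_measurable H : fixed_field mu H `<=` measurable.
Proof. by move=> E []. Qed.

(** For countable unions, the symmetric difference of the union and its translate lies in the union
    of the individual symmetric differences, which are null. *)
Lemma sigma_algebra_fixed_field H : sigma_algebra setT (fixed_field mu H).
Proof.
split.
- by split=> // g _; rewrite image_set0 setYK measure0.
- move=> E /fixed_fieldP[mE hE]; rewrite setTD; apply/fixed_fieldP.
  split; first exact: measurableC.
  by move=> g /hE; rewrite !shift_imageE preimage_setC symdistCC.
move=> E FE; have mE n : measurable (E n) by exact: fixed_field_measurable.
split=> [|g Hg]; first exact: bigcupT_measurable.
have mU : measurable (\bigcup_k E k) by exact: bigcupT_measurable.
apply: measure_negligible.
  by apply: measurableY => //; exact: measurable_shift_image.
apply: (@negligibleS _ _ _ mu (\bigcup_k ((act g @` E k) `+` E k))).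

  rewrite image_bigcup => w [[[k _ gEw] nE]|[[k _ Ew] nE]]; exists k => //.
    by left; split=> // ?; apply: nE; exists k.
  by right; split=> // ?; apply: nE; exists k.
apply: negligible_bigcup => k; apply/negligibleP.
  by apply: measurableY => //; exact: measurable_shift_image.
by have [_] := FE k; exact.
Qed.

Lemma fixed_fieldS H K : H `<=` K -> fixed_field mu K `<=` fixed_field mu H.
Proof. by move=> HK E [mE hE]; split=> // g /HK; exact: hE. Qed.

Let base (D : set M) : set (set (Omega M R)) :=
  \bigcup_(A in [set A | finite_set A /\ A `<=` D]) fin_field G mu A.

Let base_measurable D : base D `<=` measurable.
Proof. by move=> E [A _ []]. Qed.

(** The union is directed: events fixed over [A] and over [B] are both fixed over the union of [A]
    and [B]. *)
Let algebra_base D : set_algebra (base D).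
Proof.
split.
- exists set0; first by split.
  by have [] := sigma_algebra_fixed_field (pstab G set0).
- move=> E [A AD FE]; exists A => //; rewrite -setTD.
  by have [_ + _] := sigma_algebra_fixed_field (pstab G A); exact.
move=> E F [A [fA AD] FE] [B [fB BD] FF]; exists (A `|` B).
  by split; [rewrite finite_setU|rewrite subUset].
have FE' : fin_field G mu (A `|` B) E.
  by apply: fixed_fieldS FE; apply: pstabS; exact: subsetUl.
have FF' : fin_field G mu (A `|` B) F.
  by apply: fixed_fieldS FF; apply: pstabS; exact: subsetUr.
rewrite -(bigcup2E E F); have [_ _] := sigma_algebra_fixed_field (pstab G (A `|` B)).
by apply=> -[|[|n]] //=; have [] := sigma_algebra_fixed_field (pstab G (A `|` B)).
Qed.

Lemma field_of_measurable D : field_of G mu D `<=` measurable.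
Proof. by move=> E []. Qed.

Lemma sigma_algebra_field_of D : sigma_algebra setT (field_of G mu D).
Proof.
by apply: sigma_algebra_malg_closure; [exact: base_measurable|exact: algebra_base].
Qed.

Lemma fin_field_sub_field_of A D : finite_set A -> A `<=` D ->
  fin_field G mu A `<=` field_of G mu D.
Proof.
move=> fA AD E FE; apply: sub_malg_closure; first exact: base_measurable.
by exists A.
Qed.

Lemma invariant_sub_field_of D : invariant_field G mu `<=` field_of G mu D.
Proof.
move=> E JE; apply: (@fin_field_sub_field_of set0) => //.
by rewrite /fin_field pstab0.
Qed.

Lemma field_of_approx D E (e : R) : field_of G mu D E -> 0 < e ->
  exists A F, [/\ finite_set A, A `<=` D, fin_field G mu A F & symdist mu E F < e].
Proof.
move=> /(malg_closureP mu (@base_measurable D))[_ + e0] => /(_ e e0)[F [A [? ?] ?] ?].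
by exists A, F.
Qed.

(** Conjugation by [g] carries the pointwise stabilizer of the image of [A] into that of [A]. *)
Lemma shift_fin_field g A E : G g -> fin_field G mu A E ->
  fin_field G mu (g @` A) (act g @` E).
Proof.
move=> Gg /fixed_fieldP[mE hE]; apply/fixed_fieldP; split.
  exact: measurable_shift_image.
move=> h hgA; rewrite -shift_imageM.
rewrite (_ : h * g = g * (g^-1 * (h * g)))%g; last by rewrite mulgA mulgV mul1g.
rewrite shift_imageM symdist_shift ?hE//; first exact: pstab_conj.
exact: measurable_shift_image.
Qed.

(** The shift by [g] is an isometry, so translating an approximation of [E] gives one of the
    translate of [E]. *)
Lemma shift_field_of g D E : G g -> g @` D `<=` D -> field_of G mu D E ->
  field_of G mu D (act g @` E).
Proof.
move=> Gg gD DE; have mE := field_of_measurable DE.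
apply: malg_closure_closed; [exact: base_measurable|exact: measurable_shift_image|].
move=> e e0; have [A [F [fA AD FF EF]]] := field_of_approx DE e0.
exists (act g @` F); last by rewrite symdist_shift//; exact: fixed_field_measurable FF.
apply: (@fin_field_sub_field_of (g @` A)); first exact: finite_image.
  by apply: subset_trans gD; exact: image_subset.
exact: shift_fin_field.
Qed.

Lemma xi_fin_field a (B : set (borel (unit_interval R))) : measurable B ->
  fin_field G mu [set a] (@xi M R a @^-1` B).
Proof.
move=> mB; split; first exact: measurable_xi_preimage.
move=> g [Gg ga]; rewrite shift_imageE.
rewrite (_ : _ @^-1` _ = @xi M R a @^-1` B) ?setYK ?measure0//.
by apply/seteqP; split=> w; rewrite /xi /= /shift_act invgK ga.
Qed.

End shift.


(** * Events fixed by a point stabilizer *)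

Section stabilizer.
Variables (M : countType) (R : realType) (G : set (sym M)).
Variables (mu : probability (Omega M R) R).
Hypotheses (hG : subgroup G) (hmu : shift_invariant G mu).
Implicit Types (g h : sym M) (E F : set (Omega M R)).
Local Notation act g := (@shift_act M R g).
Local Notation displ g E := (symdist mu (act g @` E) E).

(** With [displV], this makes the displacement of [E] a length function on [G], because [G] acts by
    isometries. *)
Lemma displM g h E : G g -> G h -> measurable E ->
  displ (g * h)%g E <= displ g E + displ h E.
Proof.
move=> Gg Gh mE; rewrite shift_imageM.
have mh := measurable_shift_image h mE; have mg := measurable_shift_image g mE.
have mgh := measurable_shift_image g mh.
have := symdist_triangle mu mgh mg mE; rewrite (symdist_shift hmu Gg mh mE); lra.
Qed.

Lemma displV g E : G g -> measurable E -> displ (g^-1)%g E = displ g E.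
Proof.
move=> Gg mE; rewrite -(symdist_shift hmu Gg _ mE).
  by rewrite -shift_imageM mulgV shift_act1 image_id symdistC.
exact: measurable_shift_image.
Qed.

Lemma displ_approx g E F (e : R) : G g -> measurable E -> measurable F ->
  displ g F = 0 -> symdist mu E F < e -> displ g E < 2 * e.
Proof.
move=> Gg mE mF gF EF.
have mgE := measurable_shift_image g mE; have mgF := measurable_shift_image g mF.
have := symdist_triangle mu mgE mgF mE; have := symdist_triangle mu mgF mF mE.
rewrite (symdist_shift hmu Gg mE mF) gF (symdistC _ F E); lra.
Qed.

(** By subadditivity each letter costs at most [c], and letters from [H] cost nothing. *)
Lemma displ_word g (H : set (sym M)) E (c : R) (w : seq (sym M)) :
  measurable E -> G g -> H `<=` G -> (forall h, H h -> displ h E = 0) ->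
  displ g E <= c ->
  (forall x, x \in w -> [\/ x = g, x = (g^-1)%g | H x]) ->
  G (\prod_(x <- w) x)%g /\ displ (\prod_(x <- w) x)%g E <= (size w)%:R * c.
Proof.
move=> mE Gg HG H0 gc; have c0 : 0 <= c := le_trans (symdist_ge0 _ _ _) gc.
elim: w => [|x w IHw] wP.
  rewrite big_nil shift_act1 image_id symdistxx mul0r; split=> //.
  exact: subgroup1.
have [|Gw wc] := IHw; first by move=> y yw; apply: wP; rewrite in_cons yw orbT.
have [Gx xc] : G x /\ displ x E <= c.
  have [->|->|Hx] := wP x (mem_head _ _).
  - by [].
  - by rewrite displV//; split=> //; exact: subgroupV.
  - by rewrite H0//; split=> //; exact: HG.
rewrite big_cons; split; first exact: subgroupM.
by have := displM Gx Gw mE; rewrite /= -natr1 mulrDl mul1r; lra.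
Qed.

Definition malg_stab E := [set g | G g /\ displ g E = 0].

Lemma subgroup_malg_stab E : measurable E -> subgroup (malg_stab E).
Proof.
move=> mE; split.
  rewrite inE; split; first exact: subgroup1.
  by rewrite shift_act1 image_id symdistxx.
move=> g h; rewrite !inE => -[Gg g0] [Gh h0].
have GVh := subgroupV hG Gh; split; first exact: subgroupM.
apply/eqP; rewrite eq_le symdist_ge0 andbT.
by apply: le_trans (displM Gg GVh mE) _; rewrite displV// g0 h0 addr0.
Qed.

Section one_point.
Variable a : M.
Hypothesis hmax : maximal_subgroup G (stab G a).
Hypothesis hna : no_algebraicity G.

(** Otherwise the orbit of [a] under the pointwise stabilizer of [A] would be the finite set
    consisting of [a] alone. *)
Lemma no_algebraicity_moves (A : set M) : finite_set A -> ~ A a ->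
  exists2 g, pstab G A g & g a <> a.
Proof.
move=> fA nAa; apply: contrapT => nex; apply: (hna fA nAa).
apply: (@sub_finite_set _ _ [set a]) => // _ [g gA <-].
by apply: contrapT => ga; apply: nex; exists g.
Qed.

Variable E : set (Omega M R).
Hypothesis Ea : fin_field G mu [set a] E.
Hypothesis Eac : field_of G mu (~` [set a]) E.

Let mE : measurable E. Proof. by have [] := Ea. Qed.

Let stab_displ g : stab G a g -> displ g E = 0.
Proof. by move/fixed_fieldP: Ea => [_ hE] ga; apply: hE; rewrite pstab1. Qed.

(** The stabilizer of the class of [E] lies between the maximal subgroup [stab G a] and [G]. *)
Lemma malg_stab_dichotomy :
  malg_stab E = stab G a \/ invariant_field G mu E.
Proof.
have [_ _ /(_ (malg_stab E))] := hmax.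
case.
- exact: subgroup_malg_stab.
- by move=> g ga; split; [case: ga|exact: stab_displ].
- by move=> g [].
- by left.
move=> SG; right; apply/fixed_fieldP; split=> // g.
by rewrite -SG => -[].
Qed.

Lemma boundedly_maximal_invariant :
  boundedly_maximal G (stab G a) -> invariant_field G mu E.
Proof.
move=> [d hd]; have [Sa|//] := malg_stab_dichotomy.
have [_ [_ /existsNP[h /not_implyP[Gh nah]]] _] := hmax.
have h0 : 0 < displ h E.
  rewrite lt_neqAle symdist_ge0 andbT eq_sym; apply/eqP => h0.
  by apply: nah; rewrite -Sa; split.
(* An element of G displacing E by at most [2 * e] generates, with G_a, only
   elements displacing E by less than [h] does. *)
pose e := displ h E / (2 * d.+1%:R).
have d0 : (0 : R) < d.+1%:R by rewrite ltr0n.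
have e0 : 0 < e by rewrite divr_gt0// mulr_gt0.
have [A [F [fA Aa FA EF]]] := field_of_approx Eac e0.
have [g gA ga] := no_algebraicity_moves fA (fun Aa' => Aa _ Aa' erefl).
have Gg := pstab_sub gA.
have mF := fixed_field_measurable FA.
have gF : displ g F = 0 by move/fixed_fieldP: FA => [_]; exact.
have ge := displ_approx Gg mE mF gF EF.
have [w [wd wP hw]] := hd g Gg (fun '(conj _ ga') => ga ga') h Gh.
have [_] := displ_word mE Gg (fun x '(conj Gx _) => Gx) stab_displ (ltW ge) wP.
rewrite -hw; have wdR : (size w)%:R <= d%:R :> R by rewrite ler_nat.
(* The factor [d.+1] in [e] leaves a surplus of [2 * e] over the cost [d * (2 * e)] of a word of
   length [d]. *)
have : displ h E = 2 * d%:R * e + 2 * e.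
  by rewrite /e -natr1; field; rewrite nat1r lt0r_neq0.
have : (size w)%:R * (2 * e) <= d%:R * (2 * e) by rewrite ler_wpM2r//; lra.
by lra.
Qed.

(** Two realizations [a'] and [a''] over one tuple [b'] give an element [k] moving [a]. For every
    finite part of the complement of [a], [k] is, up to factors from [stab G a] on both sides, an
    element fixing that part; hence it displaces [E] by less than any [e]. *)
Lemma uniform_non_algebraicity_invariant :
  uniform_non_algebraicity G -> invariant_field G mu E.
Proof.
move=> [_ hu]; have [Sa|//] := malg_stab_dichotomy.
(* The point [c] differs from [a] and fills the places of the enumeration [b] where decoding yields
   [a] or nothing. *)
have [c0 [Gc0 _] c0a] := no_algebraicity_moves (@finite_set0 M) (fun f => f).
pose c := c0 a.
(* [b] enumerates the complement of [a]. *)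
pose b n := if @unpickle M n is Some x then if x == a then c else x else c.
have ba n : a <> b n.
  rewrite /b; case: unpickle => [x|] //; last by move/esym.
  by case: eqVneq => [_ /esym//|/eqP xa /esym].
have [b' [a' [a'' [aa' ta' ta'']]]] := hu b a ba.
have typeP x n : same_type_ext G b' x b a ->
    exists2 g, G g & g x = a /\ forall i, (i < n)%N -> g (b' i) = b i.
  move=> /(_ n)[g Gg]; rewrite map_rcons => /rcons_inj[gb gx].
  exists g => //; split=> // i ilt.
  have := congr1 (fun s => nth a s i) gb.
  by rewrite (nth_map a) ?size_mkseq// !nth_mkseq.
(* At length 0 only [g0 a' = a] and [h0 a'' = a] are asked. Hence [k a = g0 a''], which is not [a]
   because [g0] is injective. *)
have [g0 Gg0 [g0a _]] := typeP _ 0 ta'.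
have [h0 Gh0 [h0a _]] := typeP _ 0 ta''.
have inv g x y : g x = y -> (g^-1)%g y = x :> M by move=> <-; exact: symKg.
pose k := (g0 * h0^-1)%g.
have Gk : G k by apply: subgroupM => //; exact: subgroupV.
have ka : k a <> a.
  rewrite /k symMg (inv _ _ _ h0a) => g0a''.
  by apply: aa'; rewrite -(symKg g0 a') g0a -g0a'' symKg.
suff : malg_stab E k by rewrite Sa => -[].
split=> //; apply/eqP; rewrite eq_le symdist_ge0 andbT.
apply/ler_addgt0Pr => e e0; rewrite add0r.
have e20 : 0 < e / 2 by lra.
have [A [F [fA Aa FA EF]]] := field_of_approx Eac e20.
have [s sA] := (finite_seqP A).1 fA.
(* The point with code [i] other than [a] is [b i], so the first [N] entries of [b] cover [A]. *)
pose N := (\max_(x <- s) pickle x).+1.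
have bA x : A x -> exists2 i, (i < N)%N & b i = x.
  move=> Ax; exists (pickle x).
    by rewrite ltnS; apply: leq_bigmax_seq => //; move: Ax; rewrite sA.
  by rewrite /b pickleK; case: eqVneq => // xa; case: (Aa x Ax).
have [gN GgN [gNa gNb]] := typeP _ N ta'.
have [hN GhN [hNa hNb]] := typeP _ N ta''.
have GVg0 := subgroupV hG Gg0; have GVgN := subgroupV hG GgN.
have GVh0 := subgroupV hG Gh0; have GVhN := subgroupV hG GhN.
(* [p] fixes the approximation [F] of [E], and [k = u * p * v]. *)
pose u := (g0 * gN^-1)%g; pose p := (gN * hN^-1)%g; pose v := (hN * h0^-1)%g.
have Gp : G p by exact: subgroupM.
have ua : stab G a u.
  split; first exact: subgroupM.
  by rewrite symMg (inv _ _ _ gNa).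
have va : stab G a v.
  split; first exact: subgroupM.
  by rewrite symMg (inv _ _ _ h0a).
have pA : pstab G A p.
  split=> // x /bA[i iN <-].
  by rewrite symMg (inv _ _ _ (hNb i iN)) gNb.
have pE : displ p E < 2 * (e / 2).
  apply: displ_approx (fixed_field_measurable FA) _ EF => //.
  by move/fixed_fieldP: FA => [_]; exact.
have -> : k = (u * (p * v))%g.
  by rewrite /u /p /v -!mulgA !(mulgA _^-1 _ _)%g !mulVg !mul1g.
have Gpv : G (p * v)%g by apply: subgroupM => //; case: va.
have := displM (proj1 ua) Gpv mE; have := displM Gp (proj1 va) mE.
rewrite (stab_displ ua) (stab_displ va); lra.
Qed.

Lemma fixed_tail_invariant :
  uniform_non_algebraicity G \/ boundedly_maximal G (stab G a) ->
  invariant_field G mu E.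
Proof.
by case; [exact: uniform_non_algebraicity_invariant|
          exact: boundedly_maximal_invariant].
Qed.

End one_point.
End stabilizer.


(** * Conditional probabilities given the tail *)

Section pi_system.
Context d (T : measurableType d) (R : realType) (mu : probability T R).
Local Notation E f := (Rintegral mu setT f).
Local Notation bm := (bmeas (@measurable d T)).
Let sT := @sigma_algebra_measurable d T.

Lemma exp_mul_indic A B : measurable A -> measurable B ->
  E (fun x => \1_A x * \1_B x) = fine (mu (A `&` B)).
Proof.
move=> mA mB; rewrite -exp_indic; last exact: measurableI.
by congr Rintegral; apply/funext => x; rewrite indicI.
Qed.

(** The events whose indicator is orthogonal to [u] form a Dynkin system; [E u = 0] is what closes
    it under complements. *)
Lemma orthogonal_pi_system (G : set (set T)) (u : T -> R) : bm u ->
  @measurable d T = <<s G >> -> setI_closed G -> E u = 0 ->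
  (forall C, G C -> E (fun x => u x * \1_C x) = 0) ->
  forall C, measurable C -> E (fun x => u x * \1_C x) = 0.
Proof.
move=> bu mG IG Eu uG.
have EC C : E (fun x => u x * \1_C x) = Rintegral mu C u.
  by under eq_fun do rewrite mulrC; exact: exp_restrict.
have iu C : measurable C -> mu.-integrable C (EFin \o u).
  by move=> mC; apply: integrableS (bmeas_integrable mu bu).
have fin C : measurable C -> Rintegral mu C u = 0 -> (\int[mu]_(x in C) (u x)%:E = 0)%E.
  move=> mC uC; have /fineK <- := integrable_fin_num mC (iu C mC).
  by congr EFin.
rewrite [X in forall C, X C -> _]mG; apply: (@dynkin_induction _ T G
  [set C | E (fun x => u x * \1_C x) = 0] mG IG) => //=.
- by rewrite EC.
- move=> C mC uC; rewrite EC.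
  have : E u = 0 := Eu.
  rewrite -(setUv C) Rintegral_setU//.
  + by rewrite -EC uC add0r.
  + exact: measurableC.
  + by rewrite setUv; exact: iu.
  + by apply/disj_setPS => x [].
move=> F mF tF uF; rewrite EC /Rintegral.
rewrite integral_bigcup//; last by apply: iu; exact: bigcupT_measurable.
rewrite eseries0// => i _ _; apply: fin => //.
by rewrite -EC uF.
Qed.

Lemma exp_measure_preserving (phi : T -> T) f : measurable_fun setT phi ->
  (forall B, measurable B -> mu (phi @^-1` B) = mu B) -> bm f ->
  E (f \o phi) = E f.
Proof.
move=> mphi phimu bf; rewrite /Rintegral; congr fine.
have mf : measurable_fun setT (EFin \o f).
  by apply/measurable_EFinP; exact: bmeas_measurable_fun.
have bfphi : bm (f \o phi).
  have [mf' [K fK]] := bf; split; last by exists K => x; exact: fK.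
  by move=> B /mf' mfB; rewrite comp_preimage -[X in measurable X]setTI; exact: mphi.
have e1 := integral_pushforward mphi mf (bmeas_integrable mu bfphi) measurableT.
pose m1 := @measure_function_pushforward__canonical__measure_function_Measure
  _ _ _ _ _ mu _ mphi.
have e2 := @eq_measure_integral _ T R setT mu m1 (EFin \o f)
  (fun B mB _ => phimu B mB).
by rewrite preimage_setT in e1; exact: etrans (esym e1) e2.
Qed.

End pi_system.

Section tail.
Variables (M : countType) (R : realType) (G : set (sym M)).
Variables (mu : probability (Omega M R) R).
Hypotheses (hG : subgroup G) (hmu : shift_invariant G mu).
Implicit Types (g h : sym M) (E F : set (Omega M R)).
Local Notation act g := (@shift_act M R g).
Local Notation Ex f := (Rintegral mu setT f).
Local Notation bm := (@bmeas (Omega M R) R measurable).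
Local Notation J := (invariant_field G mu).
Local Notation Fc a := (field_of G mu (~` [set a])).
Let sOmega := @sigma_algebra_measurable _ (Omega M R).

Lemma exp_shift g f : G g -> bm f -> Ex (f \o act g) = Ex f.
Proof.
move=> Gg bf; apply: exp_measure_preserving => //; first exact: measurable_shift.
move=> B mB; rewrite -[RHS](hmu (subgroupV hG Gg) mB) shift_imageE invgK.
by [].
Qed.

(** Membership in the invariant field depends only on the class modulo null sets: [F] is
    approximated by the invariant [E] with arbitrarily small error. *)
Lemma invariant_field_eq0 E F : J E -> measurable F -> symdist mu F E = 0 -> J F.
Proof.
move=> /fixed_fieldP[mE EJ] mF FE; apply/fixed_fieldP; split=> // g Gg.
apply/eqP; rewrite eq_le symdist_ge0 andbT; apply/ler_addgt0Pr => e e0.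
rewrite add0r; apply: ltW.
have := @displ_approx _ _ _ _ hmu g F E (e / 2) Gg mF mE (EJ g Gg).
by rewrite FE => /(_ ltac:(lra)); rewrite mulrC divfK.
Qed.

Section cond_prob.
Variable a : M.
Hypothesis tail_inv : forall E, fin_field G mu [set a] E -> Fc a E -> J E.

(** [G_a] preserves [mu], the field [Fc a] and, up to null sets, [E]. Uniqueness thus makes a
    conditional probability of [E] given [Fc a] invariant under [G_a], so that its level sets
    satisfy both premises of [tail_inv]. *)
Lemma tail_cond_prob E : fin_field G mu [set a] E ->
  exists2 f : Omega M R -> R, bmeas J f &
    forall C, Fc a C -> Ex (fun x => f x * \1_C x) = fine (mu (E `&` C)).
Proof.
move=> Ea; have mE := fixed_field_measurable Ea.
have sF := sigma_algebra_field_of G mu (~` [set a]).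
have Fm := @field_of_measurable M R G mu (~` [set a]).
have [f bf fE] := cond_prob_exists mu sF Fm mE.
exists f => //.
have bmf := bmeas_sub Fm bf.
have Fshift g C : stab G a g -> Fc a C -> Fc a (act g @` C).
  move=> [Gg ga] FC; apply: shift_field_of => // _ [b /= ba <-] gb.
  by apply: ba; rewrite -(symKg g b) gb -ga symKg.
have stabV g : stab G a g -> stab G a (g^-1)%g.
  by move=> [Gg ga]; split; [exact: subgroupV|rewrite -{1}ga symKg].
split; last by case: bf.
move=> B mB; apply: tail_inv; last by case: bf => + _; exact.
apply/fixed_fieldP; split; first by case: bmf => + _; exact.
rewrite pstab1 => g ga; have [Gg _] := ga.
(* Both [f] and [f'] are conditional probabilities of [E] given [Fc a]. *)
pose f' := f \o act (g^-1)%g.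
have bf' : bmeas (Fc a) f'.
  split; last by have [_ [K fK]] := bf; exists K => x; exact: fK.
  move=> D mD; rewrite /f' comp_preimage -shift_imageE.
  by apply: Fshift => //; case: bf => + _; exact.
pose u x := f x - f' x.
have bu : bmeas (Fc a) u by exact: bmeasB.
have bmu := bmeas_sub Fm bu.
(* Substituting the shift by [g] turns the expectation into the measure of [E] intersected with the
   translate of [C] by the inverse of [g]. Translating by [g] gives back [C], and changes [E] only
   by a null set. *)
have Ef' C : Fc a C -> Ex (fun x => f' x * \1_C x) = fine (mu (E `&` C)).
  move=> FC; have mC := Fm _ FC.
  have FgC : Fc a (act (g^-1)%g @` C) by apply: Fshift => //; exact: stabV.
  rewrite -(_ : (fun x => f x * \1_(act (g^-1)%g @` C) x) \o act (g^-1)%g =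
      (fun x => f' x * \1_C x)); last first.
    apply/funext => x /=; congr (_ * _); rewrite !indicE; congr (nat_of_bool _)%:R.
    by rewrite shift_imageE invgK; apply/idP/idP; rewrite !inE /= shift_actVK.
  rewrite exp_shift.
  - rewrite fE//; congr fine.
    rewrite -[in LHS](hmu Gg); last by apply: measurableI => //; exact: Fm.
    rewrite shift_imageE preimage_setI -!shift_imageE -shift_imageM mulgV.
    rewrite shift_act1 image_id; apply: symdist_measureI => //.
      exact: measurable_shift_image.
    by move/fixed_fieldP: Ea => [_]; apply; rewrite pstab1.
  - exact: subgroupV.
  - by apply: (bmeasM sOmega) => //; apply: bmeas_indic => //; exact: Fm.
have uC C : Fc a C -> Ex (fun x => u x * \1_C x) = 0.
  move=> FC; have b1 : bmeas (Fc a) (\1_C : Omega M R -> R) by exact: bmeas_indic.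
  have -> : (fun x => u x * \1_C x) = (fun x => f x * \1_C x - f' x * \1_C x).
    by apply/funext => x; rewrite mulrBl.
  by rewrite expB ?fE ?Ef' ?subrr//; apply: (bmeas_sub Fm); exact: bmeasM.
(* The function [u] is orthogonal to [Fc a] and measurable for it; testing against [u] itself shows
   that [f] and [f'] agree almost everywhere. *)
have u0 := exp_sqr_eq0 bmu (orthogonal_bmeas sF Fm bmu uC bu).
rewrite /symdist; suff -> : mu (act g @` (f @^-1` B) `+` f @^-1` B) = 0%E by [].
have mfB : measurable (f @^-1` B) by case: bmf => + _; exact.
apply: measure_negligible.
  by apply: measurableY => //; exact: measurable_shift_image.
apply: (@negligibleS _ _ _ mu [set x | u x != 0]); last first.
  apply/negligibleP => //.
  have -> : [set x | u x != 0] = u @^-1` (~` [set 0]).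
    by apply/seteqP; split=> x /= /eqP.
  by case: bmu => + _; apply; exact: measurableC.
rewrite shift_imageE => x; rewrite /= -/(f' x) subr_eq0 => xB.
apply/eqP => fx; move: xB; rewrite -/(f' x).
by rewrite -[f (shift_act _ x)]/(f' x) -fx; tauto.
Qed.

End cond_prob.
End tail.


(** * Replacing indicators by conditional probabilities, one factor at a time *)

Section product.
Context d (T : measurableType d) (R : realType) (mu : probability T R).
Local Notation E f := (Rintegral mu setT f).
Local Notation bm := (@bmeas T R measurable).
Let sT := @sigma_algebra_measurable d T.

Variables (I : eqType) (J : set (set T)) (F : I -> set (set T)).
Hypotheses (sF : forall i, sigma_algebra setT (F i))
  (Fm : forall i, F i `<=` measurable) (JF : forall i, J `<=` F i).
Variables (A : I -> set T) (f : I -> T -> R).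
Hypotheses (AF : forall i j, i != j -> F j (A i))
  (mA : forall i, measurable (A i)) (bf : forall i, bmeas J (f i))
  (fA : forall i C, F i C -> E (fun x => f i x * \1_C x) = fine (mu (A i `&` C))).

(** The difference of [f i] and the indicator of [A i] is orthogonal to [F i]. *)
Lemma exp_replace i Z : bmeas (F i) Z ->
  E (fun x => Z x * \1_(A i) x) = E (fun x => Z x * f i x).
Proof.
move=> bZ; have bZm := bmeas_sub (@Fm i) bZ.
have bfF := bmeas_sub (@JF i) (bf i); have bfm := bmeas_sub (@Fm i) bfF.
have bAm : bm (\1_(A i)) by exact: bmeas_indic.
have bu : bm (fun x => f i x - \1_(A i) x) by exact: bmeasB.
have uC C : F i C -> E (fun x => (f i x - \1_(A i) x) * \1_C x) = 0.
  move=> FC; have mC := Fm FC; have bC : bm (\1_C) by exact: bmeas_indic.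
  have -> : (fun x => (f i x - \1_(A i) x) * \1_C x) =
      (fun x => f i x * \1_C x - \1_(A i) x * \1_C x).
    by apply/funext => x; rewrite mulrBl.
  by rewrite expB ?fA ?exp_mul_indic ?subrr//; exact: bmeasM.
have := orthogonal_bmeas (@sF i) (@Fm i) bu uC bZ.
have -> : (fun x => (f i x - \1_(A i) x) * Z x) =
    (fun x => Z x * f i x - Z x * \1_(A i) x).
  by apply/funext => x; rewrite mulrC mulrBr.
by rewrite expB; [move/eqP; rewrite subr_eq0 => /eqP|exact: bmeasM..].
Qed.

(** When factor [i] is replaced, the remaining indicators are [F i]-measurable because [i] does not
    recur. Afterwards [f i], being [J]-measurable, is absorbed into the weight [Z], which must be
    measurable for every [F j]. *)
Lemma exp_prod_replace (s : seq I) Z : uniq s ->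
  (forall i, bmeas (F i) Z) ->
  E (fun x => Z x * \prod_(i <- s) \1_(A i) x) =
  E (fun x => Z x * \prod_(i <- s) f i x).
Proof.
elim: s Z => [|i s IHs] Z /=.
  by move=> _ _; congr Rintegral; apply/funext => x; rewrite !big_nil.
move=> /andP[nis us] bZ.
transitivity (E (fun x => (Z x * \prod_(j <- s) \1_(A j) x) * \1_(A i) x)).
  by congr Rintegral; apply/funext => x; rewrite big_cons mulrCA mulrC.
rewrite exp_replace; last first.
  apply: (bmeasM (@sF i)) => //; apply: bmeas_prod => // j js.
  have ji : j != i by apply: contraNneq nis => <-.
  exact: (bmeas_indic R (@sF i) (AF ji)).
transitivity (E (fun x => (Z x * f i x) * \prod_(j <- s) \1_(A j) x)).
  by congr Rintegral; apply/funext => x; rewrite mulrAC.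
rewrite IHs//; last first.
  by move=> j; apply: (bmeasM (@sF j)) => //; exact: bmeas_sub (bf i).
by congr Rintegral; apply/funext => x; rewrite big_cons mulrA.
Qed.

End product.

Lemma prod_indic (T : Type) (R : realType) (I : eqType) (s : seq I)
    (A : I -> set T) x :
  \prod_(i <- s) \1_(A i) x = \1_(\bigcap_(i in [set` s]) A i) x :> R.
Proof.
elim: s => [|i s IHs].
  by rewrite big_nil indicE mem_set// => i.
rewrite big_cons IHs -[RHS]/(\1__ x).
have -> : \bigcap_(j in [set` i :: s]) A j = A i `&` \bigcap_(j in [set` s]) A j.
  apply/seteqP; split=> y /=.
    by move=> yA; split=> [|j js]; apply: yA; rewrite /= in_cons ?eqxx// js orbT.
  by move=> [yi ys] j /=; rewrite in_cons => /predU1P[->//|]; exact: ys.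
by rewrite indicI.
Qed.

(** * Conditional probabilities given the invariant field, and the ergodic case *)

Section invariant.
Context d (T : measurableType d) (R : realType) (mu : probability T R).
Local Notation E f := (Rintegral mu setT f).
Let sT := @sigma_algebra_measurable d T.
Variable J : set (set T).
Hypotheses (sJ : sigma_algebra setT J) (Jm : J `<=` measurable).

Lemma bmeas_cond_prob_version (g : T -> R) A : bmeas J g -> measurable A ->
  (forall C, J C -> E (fun x => g x * \1_C x) = fine (mu (A `&` C))) ->
  cond_prob_version mu J A g.
Proof.
move=> bg mA gA; have bgm := bmeas_sub Jm bg; have ig := bmeas_integrable mu bgm.
split; [by case: bg|exact: ig|] => C JC; have mC := Jm JC.
have igC := integrable_fin_num mC (integrableS measurableT mC (@subsetT _ _) ig).
rewrite -[RHS]fineK ?fin_num_measure//; last exact: measurableI.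
rewrite -gA// -[LHS]fineK//; congr EFin.
by under [in RHS]eq_fun do rewrite mulrC; rewrite exp_restrict.
Qed.

(** Events of measure 0 or 1 are independent of [A], so [f] minus the measure of [A] is orthogonal
    to [J]. *)
Lemma ergodic_exp_mul (A : set T) (f Z : T -> R) :
  (forall C, J C -> mu C = 0%E \/ mu C = 1%E) -> measurable A -> bmeas J f ->
  (forall C, J C -> E (fun x => f x * \1_C x) = fine (mu (A `&` C))) ->
  bmeas J Z -> E (fun x => Z x * f x) = fine (mu A) * E Z.
Proof.
move=> erg mA bf fA bZ; set c := fine (mu A).
have bfm := bmeas_sub Jm bf; have bZm := bmeas_sub Jm bZ.
have bu : bmeas measurable (fun x => f x - c).
  by apply: (bmeasB sT) => //; exact: bmeas_cst.
have AC C : J C -> fine (mu (A `&` C)) = c * fine (mu C).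
  move=> JC; have mC := Jm JC; have mAC : measurable (A `&` C) by exact: measurableI.
  have [C0|C1] := erg C JC.
    rewrite C0 mulr0; apply/eqP; rewrite eq_le fine_ge0// andbT.
    by rewrite -[leRHS]/(fine 0%E) -C0; apply: fine_measure_le.
  have -> : c = fine (mu (setT `&` A)) by rewrite setTI.
  rewrite C1 mulr1 [A `&` C]setIC; congr fine; apply: symdist_measureI => //.
  by rewrite /symdist setYTC probability_setC// C1 subee.
have uC C : J C -> E (fun x => (f x - c) * \1_C x) = 0.
  move=> JC; have mC := Jm JC; have bC : bmeas measurable (\1_C : T -> R).
    exact: bmeas_indic.
  have -> : (fun x => (f x - c) * \1_C x) = (fun x => f x * \1_C x - c * \1_C x).
    by apply/funext => x; rewrite mulrBl.
  rewrite expB; [|exact: bmeasM|exact: bmeasZ].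
  by rewrite fA// expZ// exp_indic// AC// subrr.
have := orthogonal_bmeas sJ Jm bu uC bZ.
have -> : (fun x => (f x - c) * Z x) = (fun x => Z x * f x - c * Z x).
  by apply/funext => x; rewrite mulrBl [f x * _]mulrC.
rewrite expB; [|exact: bmeasM|exact: bmeasZ].
by rewrite expZ// => /eqP; rewrite subr_eq0 => /eqP.
Qed.

(** The weight [Z] carries the induction: the factor [f i] is moved into it. *)
Lemma exp_prod_const (I : eqType) (f : I -> T -> R) (c : I -> R) (s : seq I) Z :
  (forall i, bmeas J (f i)) ->
  (forall i Z, bmeas J Z -> E (fun x => Z x * f i x) = c i * E Z) ->
  bmeas J Z ->
  E (fun x => Z x * \prod_(i <- s) f i x) = (\prod_(i <- s) c i) * E Z.
Proof.
move=> bf fc; elim: s Z => [|i s IHs] Z bZ.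
  rewrite big_nil mul1r; congr Rintegral.
  by apply/funext => x; rewrite big_nil mulr1.
rewrite big_cons mulrAC -fc// mulrC -IHs//; last exact: bmeasM.
by congr Rintegral; apply/funext => x; rewrite big_cons mulrA.
Qed.

End invariant.

(** * The de Finetti theorem *)

Section main.
Variables (R : realType) (M : countType) (G : set (sym M)).
Hypotheses (hG : subgroup G) (hna : no_algebraicity G).
Hypothesis hmax : forall a : M, maximal_subgroup G (stab G a).
Hypothesis hcond : uniform_non_algebraicity G \/
  (forall a : M, boundedly_maximal G (stab G a)).
Variable mu : probability (Omega M R) R.
Hypothesis hmu : shift_invariant G mu.

Local Notation J := (invariant_field G mu).
Local Notation Fc a := (field_of G mu (~` [set a])).
Local Notation Ex f := (Rintegral mu setT f).
Local Notation bm := (@bmeas (Omega M R) R measurable).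
Let sOmega := @sigma_algebra_measurable _ (Omega M R).
Let sJ : sigma_algebra setT J := sigma_algebra_fixed_field mu G.
Let Jm : J `<=` measurable := @fixed_field_measurable _ _ mu G.
Let sF a : sigma_algebra setT (Fc a) := sigma_algebra_field_of G mu _.
Let Fm a : Fc a `<=` measurable := @field_of_measurable _ _ G mu _.
Let JF a : J `<=` Fc a := @invariant_sub_field_of _ _ G mu _.

Lemma tail_in_fin_invariant a E : fin_field G mu [set a] E -> Fc a E -> J E.
Proof.
move=> Ea Eac; apply: (fixed_tail_invariant hG hmu (hmax a) hna Ea Eac).
by case: hcond => [|h]; [left|right].
Qed.

(** The common source of the three conclusions. The weight [Z] will be the indicator of a tail event
    and its conditional probability given [J], then the indicator of an invariant event, and finally
    the constant 1. *)
Lemma cylinder_cond_prob (B : M -> set (borel (unit_interval R))) :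
  (forall a, measurable (B a)) -> exists f : M -> Omega M R -> R,
  [/\ forall a, bmeas J (f a),
    forall a C, Fc a C -> Ex (fun x => f a x * \1_C x) =
      fine (mu ((@xi M R a @^-1` B a) `&` C)) &
    forall s Z, uniq s -> (forall a, bmeas (Fc a) Z) ->
      Ex (fun x => Z x * \1_(cylinder s B) x) =
      Ex (fun x => Z x * \prod_(a <- s) f a x)].
Proof.
move=> mB.
have /choice[f fP] a : exists f, bmeas J f /\ forall C, Fc a C ->
    Ex (fun x => f x * \1_C x) = fine (mu ((@xi M R a @^-1` B a) `&` C)).
  have [f bf fE] := tail_cond_prob hG hmu (@tail_in_fin_invariant a)
    (xi_fin_field G mu a (mB a)).
  by exists f.
exists f; split=> [a|a|s Z us bZ].
1-2: by have [] := fP a.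
rewrite -(@exp_prod_replace _ _ _ mu M J (fun a => Fc a) sF Fm JF
  (fun a => @xi M R a @^-1` B a) f)//.
- by congr Rintegral; apply/funext => x; rewrite prod_indic.
- move=> a b ab; apply: (@fin_field_sub_field_of _ _ _ _ [set a]) => //.
    by move=> _ -> /= /eqP; rewrite (negbTE ab).
  exact: xi_fin_field.
- by move=> a; exact: measurable_xi_preimage.
- by move=> a; have [] := fP a.
- by move=> a C; have [_] := fP a; exact.
Qed.

Lemma tail_sub_invariant : dynamical_tail G mu `<=` J.
Proof.
move=> C TC; have FC a : Fc a C by apply: TC; exact: finite_set1.
have mC : measurable C by have /field_of_measurable := TC set0 (@finite_set0 M).
have [f bf fC] := cond_prob_exists mu sJ Jm mC.
have bfm := bmeas_sub Jm bf; have bCm : bm (\1_C) by exact: bmeas_indic.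
pose u x : R := f x - \1_C x.
have bu : bm u by exact: bmeasB.
have uE (Z : Omega M R -> R) : bm Z ->
    Ex (fun x => u x * Z x) = Ex (fun x => f x * Z x) - Ex (fun x => \1_C x * Z x).
  move=> bZ; rewrite -expB; [|exact: bmeasM..].
  by congr Rintegral; apply/funext => x; rewrite mulrBl.
have uJ D : J D -> Ex (fun x => u x * \1_D x) = 0.
  move=> JD; have mD := Jm JD; rewrite uE; last exact: bmeas_indic.
  by rewrite fC// exp_mul_indic// subrr.
(* Both [f] and the indicator of [C] are measurable for every [Fc a], so against either one the
   cylinder may be replaced by a [J]-measurable product, to which [u] is orthogonal. *)
have ucyl D : cylinders D -> Ex (fun x => u x * \1_D x) = 0.
  move=> [s [B [us mB ->]]]; have [h [bh _ hP]] := cylinder_cond_prob mB.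
  have mcyl : measurable (cylinder s B).
    exact: measurable_cylinder.
  have bp : bmeas J (fun x => \prod_(a <- s) h a x) by exact: bmeas_prod.
  rewrite uE; last exact: bmeas_indic.
  have bFf a : bmeas (Fc a) f by exact: bmeas_sub (@JF a) bf.
  have bFC a : bmeas (Fc a) (\1_C : Omega M R -> R).
    by apply: bmeas_indic; [exact: sF|exact: FC].
  rewrite !hP//.
  by rewrite -uE ?(orthogonal_bmeas sJ Jm bu uJ bp)//; exact: bmeas_sub bp.
have Eu : Ex u = 0.
  have := uJ setT; rewrite (_ : (fun x => u x * \1_setT x) = u).
    by apply; rewrite -setC0 -setTD; case: sJ => J0 + _; exact.
  by apply/funext => x; rewrite indicT mulr1.
have uD := orthogonal_pi_system bu (measurable_cylinders M R)
  (@setI_closed_cylinders M R) Eu ucyl.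
have u0 := exp_sqr_eq0 bu (orthogonal_bmeas sOmega (@subset_refl _ _) bu uD bu).
(* Since [f] is almost everywhere the indicator of [C], the event [C] is the level set of [f] at 1
   up to a null set. *)
have Jf1 : J (f @^-1` [set 1]) by case: bf => + _; exact.
apply: (invariant_field_eq0 hmu Jf1) => //.
rewrite /symdist; suff -> : mu (C `+` f @^-1` [set 1]) = 0%E by [].
apply: measure_negligible; first by apply: measurableY => //; exact: Jm.
apply: (@negligibleS _ _ _ mu [set x | u x != 0]); last first.
  apply/negligibleP => //.
  have -> : [set x | u x != 0] = u @^-1` (~` [set 0]).
    by apply/seteqP; split=> x /= /eqP.
  by case: bu => + _; apply; exact: measurableC.
move=> x /=; rewrite /u subr_eq0 indicE => -[[Cx nf]|[-> nC]].
  by rewrite mem_set//; apply/eqP.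
by rewrite memNset//= oner_eq0.
Qed.

Lemma tail_eq_invariant : dynamical_tail G mu = J.
Proof.
apply/seteqP; split; first exact: tail_sub_invariant.
by move=> E JE A _; exact: invariant_sub_field_of.
Qed.

Lemma invariant_cond_independent : cond_independent mu J (@xi M R).
Proof.
move=> s us B mB; have [f [bf fF fs]] := cylinder_cond_prob mB.
exists f; split=> [a _|]; apply: (bmeas_cond_prob_version Jm) => //.
- exact: measurable_xi_preimage.
- by move=> C /(@JF a); exact: fF.
- exact: bmeas_prod.
- exact: measurable_cylinder.
move=> C JC; have mC := Jm JC.
transitivity (Ex (fun x => \1_C x * \prod_(a <- s) f a x)).
  by congr Rintegral; apply/funext => x; rewrite mulrC.
have bC a : bmeas (Fc a) (\1_C : Omega M R -> R).
  by apply: bmeas_indic; [exact: sF|exact: JF].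
rewrite -fs// exp_mul_indic// 1?setIC//.
exact: measurable_cylinder.
Qed.

Lemma ergodic_product_measure : ergodic G mu -> product_measure mu.
Proof.
move=> erg.
pose X (a : M) : {mfun Omega M R >-> borel (unit_interval R)} :=
  mfun_Sub (mem_set (@measurable_xi M R a)).
exists (fun a => distribution mu (X a)) => s us B mB.
have [f [bf fF fs]] := cylinder_cond_prob mB.
pose c a : R := fine (mu (@xi M R a @^-1` B a)).
(* Against [J]-measurable weights each [f a] acts as the constant [c a], so the expectation of the
   product is the product of the marginal probabilities. *)
have fc a Z : bmeas J Z -> Ex (fun x => Z x * f a x) = c a * Ex Z.
  apply: (ergodic_exp_mul sJ Jm erg) => // [|C /(@JF a)]; last exact: fF.
  exact: measurable_xi_preimage.
have mcyl := measurable_cylinder s mB.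
rewrite -[X in X = _]/(mu (cylinder s B)) -[LHS]fineK ?fin_num_measure//.
have -> : fine (mu (cylinder s B)) = \prod_(a <- s) c a.
  have bT : bmeas J (cst (1 : R)) := bmeas_cst sJ 1.
  have := exp_prod_const sJ s bf fc bT; rewrite exp_cst mulr1 => <-.
  rewrite -fs//; last by move=> a; exact: bmeas_cst.
  rewrite -exp_indic//; congr Rintegral.
  by apply/funext => x; rewrite mul1r.
rewrite -prodEFin; apply: eq_bigr => a _; rewrite fineK// fin_num_measure//.
exact: measurable_xi_preimage.
Qed.

End main.

Theorem theorem4p10 (R : realType) (M : countType) (G : set (sym M))
    (hG : subgroup G)
    (hna : no_algebraicity G)
    (hmax : forall a : M, maximal_subgroup G (stab G a))
    (hcond : uniform_non_algebraicity G \/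
             (forall a : M, boundedly_maximal G (stab G a)))
    (mu : probability (Omega M R) R)
    (hmu : shift_invariant G mu) :
  [/\ dynamical_tail G mu = invariant_field G mu,
      cond_independent mu (invariant_field G mu) (@xi M R) &
      ergodic G mu -> product_measure mu].
Proof.
split.
- exact: tail_eq_invariant.
- exact: invariant_cond_independent.
- exact: ergodic_product_measure.
Qed.
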